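(* Let $U$ be as in the context. Every smooth point $y_0$ of $\partial U$ (i.e. every point of $\partial U$ that is not a vertex) has a $U$-neighborhood that does not intersect the $p$-ridge $R_p$; that is, there is an open set $W\ni y_0$ in $\mathbb{R}^2$ with $W\cap U\cap R_p=\emptyset$.
   Context: Fix $p\in[2,\infty)$ and let $\gamma_p((x_1,x_2))=(|x_1|^p+|x_2|^p)^{1/p}$ on $\mathbb{R}^2$. $U\subset\mathbb{R}^2$ is a simply connected bounded open set whose boundary is a simple closed Jordan curve consisting of arcs $S_1,\dots,S_m$ that are $C^{k_0,\alpha_0}$ ($k_0\ge3$, $0<\alpha_0<1$) or analytic up to their endpoints; $V_i=\bar S_i\cap\bar S_{i+1}$ (indices cyclic) are the vertices, all of which are nonreentrant corners, i.e. their opening angle (measured inside $U$) is less than $\pi$. Write $d_p(x)=\min_{y\in\partial U}\gamma_p(x-y)$; a point $y\in\partial U$ attaining the minimum is a $p$-closest point to $x$. The following standing assumption holds. At every point $y_0$ of some $S_i$ (endpoints included) where the normal to $S_i$ is parallel to a coordinate axis, after interchanging and/or reflecting the coordinate axes so that $S_i$ is near $y_0$ a graph $s\mapsto(s+a_0,b(s))$ with $y_0=(a_0,b(0))$, $b'(0)=0$ and $U$ locally above it, one has $b'(s)=c(s)|c(s)|^{p-2}$ with $c(0)=0$ and $c$ of class $C^{k_0-1,\alpha_0}$; moreover $1-c'(0)d_p(x)\ne0$ for every $x\in U$ having $y_0$ as its only $p$-closest point on $\partial U$. The $p$-ridge $R_p$ is the complement in $U$ of the largest open subset of $U$ over which $d_p$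 is $C^{1,1}$, i.e. the set of $x\in U$ having no neighborhood on which $d_p$ is $C^{1,1}$. (It is known that $R_p$ consists of the points of $U$ with more than one $p$-closest point on $\partial U$, together with the points $x$ with unique $p$-closest point $y$ at which $d_p(x)=1/\kappa_p(y)$, where for a parametrization $(a,b)$ of $\partial U$ near $y$ (with $U$ on its left) $\kappa_p=\frac{a'b''-b'a''}{(p-1)|a'|^{\frac{p-2}{p-1}}|b'|^{\frac{p-2}{p-1}}(|a'|^{\frac p{p-1}}+|b'|^{\frac p{p-1}})^{\frac{p+1}p}}$, with value $c'(0)$ at points where the normal is parallel to a coordinate axis.) *)

(* Defs.v *)
From HB Require Import structures.
From mathcomp Require Import all_boot all_order all_algebra.
From mathcomp Require Import all_classical all_reals all_analysis.
Set Implicit Arguments.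
Unset Strict Implicit.
Unset Printing Implicit Defensive.
Import Order.TTheory GRing.Theory Num.Theory.
Import numFieldNormedType.Exports.
Local Open Scope classical_set_scope.
Local Open Scope ring_scope.

Section Topology.
Context {R : realType}.

Definition boundary (U : set (R * R)) : set (R * R) :=
  closure U `\` U°.

(* Nonempty, path connected, and every loop is freely null-homotopic in U. *)
Definition simply_connected (U : set (R * R)) : Prop :=
  [/\ U !=set0,
      forall x y, U x -> U y ->
        exists f : R -> R * R,
          [/\ {within `[0, 1], continuous f},
              forall t : R, t \in `[0, 1] -> U (f t), f 0 = x & f 1 = y]
    & forall f : R -> R * R,
        {within `[0, 1], continuous f} ->
        (forall t : R, t \in `[0, 1] -> U (f t)) -> f 0 = f 1 ->
        exists (H : R * R -> R * R) (x0 : R * R),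
          [/\ {within `[0, 1]%classic `*` `[0, 1]%classic, continuous H},
              forall s t : R, s \in `[0, 1] -> t \in `[0, 1] -> U (H (s, t)),
              forall t : R, t \in `[0, 1] -> H (0, t) = f t /\ H (1, t) = x0
            & forall s : R, s \in `[0, 1] -> H (s, 0) = H (s, 1)]].

End Topology.

Section Regularity.
Context {R : realType}.

(* Class C^{k, al} on an open set A of the line, with a uniform Hoelder
   constant for the k-th derivative. *)
Definition CkHolder (k : nat) (al : R) (A : set R) (f : R -> R) : Prop :=
  (forall j x, (j < k)%N -> A x -> derivable (f^`(j))%classic x 1) /\
  exists C : R, forall x y, A x -> A y ->
    `|(f^`(k))%classic x - (f^`(k))%classic y| <= C * `|x - y| `^ al.

Definition analytic_at (f : R -> R) (x : R) : Prop :=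
  exists (r : R) (u : nat -> R), 0 < r /\
    forall y, `|y - x| < r -> series (fun n => u n * (y - x) ^+ n) @ \oo --> f y.

(* C^{1,1} on an open set A of the plane: the differential is Lipschitz. *)
Definition C11 (A : set (R * R)) (f : R * R -> R) : Prop :=
  (forall x, A x -> differentiable f x) /\
  exists L : R, forall x y v, A x -> A y ->
    `|'d f x v - 'd f y v| <= L * `|x - y| * `|v|.

End Regularity.

Section Distance.
Context {R : realType}.
Implicit Types (p : R) (U : set (R * R)) (x y : R * R).

Definition gammap p x : R := (`|x.1| `^ p + `|x.2| `^ p) `^ p^-1.

(* The infimum is a minimum as soon as the boundary is compact and nonempty. *)
Definition dp p U x : R := inf [set gammap p (x - y) | y in boundary U].

Definition p_closest p U x y : Prop :=
  boundary U y /\ gammap p (x - y) = dp p U x.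

Definition pridge p U : set (R * R) :=
  [set x | U x /\
     ~ exists A : set (R * R), [/\ open A, A x, A `<=` U & C11 A (dp p U)]].

End Distance.

Section Boundary_arcs.
Context {R : realType}.
Implicit Types (U : set (R * R)) (g : R -> R * R).

(* An arc is parametrized by `[0, 1]; "up to the endpoints" means that the
   parametrization g is the restriction of a map with the same regularity on a
   neighborhood of `[0, 1], and g denotes this extended map. *)
Definition CkHolder_arc (k : nat) (al : R) g : Prop :=
  exists2 e : R, 0 < e &
    CkHolder k al `]- e, 1 + e[%classic (fst \o g) /\
    CkHolder k al `]- e, 1 + e[%classic (snd \o g).

Definition analytic_arc g : Prop :=
  forall t : R, t \in `[0, 1] ->
    analytic_at (fst \o g) t /\ analytic_at (snd \o g) t.

Definition tangent g (t : R) : R * R := (((fst \o g)^`())%classic t, ((snd \o g)^`())%classic t).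

Definition normal_at g (t : R) : R * R := (- (tangent g t).2, (tangent g t).1).

Definition axis_parallel (v : R * R) : Prop := v.1 = 0 \/ v.2 = 0.

(* The arcs follow each other cyclically: the end of arc i is the beginning of
   arc i + 1, and this common point is the vertex V_i. *)
Definition vertex m (S : 'I_m -> R -> R * R) (i : 'I_m) : R * R := S i 1.

Definition jordan_boundary (k0 : nat) (al0 : R) U m (S : 'I_m -> R -> R * R) :
    Prop :=
  [/\ boundary U = \bigcup_(i in [set: 'I_m]) (S i @` `[0, 1]),
      forall i, S i 1 = S (ordS i) 0,
      forall i j (s t : R), s \in `[0, 1[ -> t \in `[0, 1[ ->
        S i s = S j t -> i = j /\ s = t,
      forall i, CkHolder_arc k0 al0 (S i) \/ analytic_arc (S i)
    & forall i (t : R), t \in `[0, 1] -> tangent (S i) t != 0].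

(* U has opening angle th at V: U is asymptotic at V to the sector of the
   directions phi + tau with 0 < tau < th. *)
Definition opening_angle U (V : R * R) (th : R) : Prop :=
  0 <= th <= 2 * pi /\
  exists phi : R,
    (forall tau : R, 0 < tau < th ->
       \forall r \near 0^'+, U (V + r *: (cos (phi + tau), sin (phi + tau)))) /\
    (forall tau : R, th < tau < 2 * pi ->
       \forall r \near 0^'+, ~ U (V + r *: (cos (phi + tau), sin (phi + tau)))).

Definition nonreentrant U (V : R * R) : Prop :=
  exists2 th, opening_angle U V th & th < pi.

End Boundary_arcs.

Section Axis_parallel_normals.
Context {R : realType}.
Implicit Types (U : set (R * R)) (g : R -> R * R).

(* Interchange and/or reflection of the coordinate axes. *)
Definition signed_swap (sw e1 e2 : bool) (x : R * R) : R * R :=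
  let y := if sw then (x.2, x.1) else x in
  ((-1) ^+ e1 * y.1, (-1) ^+ e2 * y.2).

(* In the coordinates T, the arc g is near its point of parameter t0 (possibly
   an endpoint) the graph s |-> (a0 + s, b s) with b'(0) = 0, and U lies
   locally above the arc; b is defined on a full neighborhood of 0 even when
   only one side of it parametrizes the arc. The height h up to which U is seen
   above the arc depends on the point, since the adjacent arc may meet g at a
   vertex with any angle. *)
Definition graph_below U g (t0 : R) (T : R * R -> R * R) (e : R) (b : R -> R) :
    Prop :=
  let a0 := (T (g t0)).1 in
  [/\ 0 < e, (b^`())%classic 0 = 0
    & exists2 d : R, 0 < d & forall t : R, t \in `[0, 1] -> `|t - t0| < d ->
        (exists2 s, `|s| < e & T (g t) = (s + a0, b s)) /\
        (0 < t < 1 -> \forall h \near 0^'+,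
           (T @` U) (T (g t) + (0, h)) /\ ~ (T @` U) (T (g t) - (0, h)))].

Definition only_p_closest (p : R) U (x y : R * R) : Prop :=
  p_closest p U x y /\ forall z, p_closest p U x z -> z = y.

Definition axis_parallel_condition (p : R) (k0 : nat) (al0 : R) U m
    (S : 'I_m -> R -> R * R) : Prop :=
  forall (i : 'I_m) (t0 : R), t0 \in `[0, 1] ->
    axis_parallel (normal_at (S i) t0) ->
    exists (sw e1 e2 : bool) (e : R) (b c : R -> R),
      [/\ graph_below U (S i) t0 (signed_swap sw e1 e2) e b,
          forall s : R, `|s| < e -> is_derive s 1 b (c s * `|c s| `^ (p - 2)),
          c 0 = 0,
          CkHolder k0.-1 al0 `]- e, e[%classic c
        & forall x, U x -> only_p_closest p U x (S i t0) ->
            1 - (c^`())%classic 0 * dp p U x != 0].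

End Axis_parallel_normals.

(* Main.v *)
(* Near a smooth boundary point the boundary is a curve g carrying a Lipschitz
   field n of nonzero vectors dual to its normals: for every x whose nearest point
   is g t, the first-order condition says exactly that x - g t is parallel to n t.
   With phi s = s |s|^(p-2), this condition is phi(n1) g1' + phi(n2) g2' = 0, so n
   is obtained by inverting phi, which is Lipschitz away from 0; where the normal
   is parallel to an axis, the assumption b' = phi(c) gives n = (-c, 1).  Since n is
   transversal to g, the cross product of x - g t and n t is strongly monotone in t
   for x close to g, so that the nearest point is a Lipschitz function of x near the
   given boundary point.  As d_p^p is an infimum of functions of class C^{1,1}, it
   follows that d_p^p, and hence d_p away from the boundary, is of class C^{1,1}. *)

Require Import Defs.
From HB Require Import structures.
From mathcomp Require Import all_boot all_order all_algebra.
From mathcomp Require Import all_classical all_reals all_analysis.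
From mathcomp Require Import ring lra zify.
Import Order.TTheory GRing.Theory Num.Theory.
Import numFieldNormedType.Exports.
Local Open Scope classical_set_scope.
Local Open Scope ring_scope.

(** * The signed power and its expansions *)

Section SignedPower.
Context {R : realType}.
Implicit Types (p r a b t M : R).

(** Young's inequality for [b] and a^(r-1), with the conjugate exponents r and r/(r-1), rearranges
    into this tangent-line inequality for the convex function t^r. *)
Lemma powR_tangent r a b : 1 <= r -> 0 <= a -> 0 <= b ->
  r * a `^ (r - 1) * (b - a) <= b `^ r - a `^ r.
Proof.
move=> r1 a0 b0; have r0 : 0 < r by lra.
have [->|rN1] := eqVneq r 1.
  by rewrite subrr powRr0 !powRr1// !mul1r.
have r1' : 0 < r - 1 by rewrite subr_gt0 lt_neqAle eq_sym rN1.
have e1 : a `^ (r - 1) * a = a `^ r by rewrite mulrC mulr_powRB1.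
have := @conjugate_powR _ b (a `^ (r - 1)) r (r / (r - 1)) b0 (powR_ge0 _ _) r0.
rewrite divr_gt0// -powRrM mulrCA divff ?gt_eqF// mulr1 invf_div.
have -> : r^-1 + (r - 1) / r = 1 by field; rewrite gt_eqF.
move=> /(_ isT erefl) H.
have {H} : r * (b * a `^ (r - 1)) <= b `^ r + (r - 1) * a `^ r.
  have -> : b `^ r + (r - 1) * a `^ r =
    r * (b `^ r / r + a `^ r * ((r - 1) / r)) by field; rewrite gt_eqF.
  by rewrite ler_pM2l// (le_trans H)// lerD2l invf_div.
by rewrite -e1; nra.
Qed.

(** This is sign(t) |t|^(p-1), the derivative of |t|^p / p, and the map through which the assumption
    on axis-parallel normals expresses b' by c. *)
Definition spow p t := t * `|t| `^ (p - 2).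

Lemma spowN p t : spow p (- t) = - spow p t.
Proof. by rewrite /spow normrN mulNr. Qed.

Lemma spow0 p : spow p 0 = 0.
Proof. by rewrite /spow mul0r. Qed.

Lemma spow1 p : spow p 1 = 1.
Proof. by rewrite /spow normr1 powR1 mul1r. Qed.

Lemma spowM p a b : spow p (a * b) = spow p a * spow p b.
Proof. by rewrite /spow normrM powRM// mulrACA. Qed.

Lemma ge0_spow p t : 2 <= p -> 0 <= t -> spow p t = t `^ (p - 1).
Proof.
move=> p2 t0; rewrite /spow ger0_norm// -{1}[t]powRr1// -powRD.
  by congr (_ `^ _); ring.
by rewrite gt_eqF//; lra.
Qed.

Lemma normr_spow p t : 2 <= p -> `|spow p t| = `|t| `^ (p - 1).
Proof.
by move=> p2; rewrite -ge0_spow// /spow normrM (ger0_norm (powR_ge0 _ _)) normr_id.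
Qed.

Lemma mulr_spow p t : 2 <= p -> spow p t * t = `|t| `^ p.
Proof.
move=> p2; rewrite -(@mulr_powRB1 _ `|t| p)//; last lra.
by rewrite -ge0_spow// /spow normr_id mulrAC mulrA -!expr2 real_normK// num_real.
Qed.

Lemma spow_inj p : 2 <= p -> injective (spow p).
Proof.
move=> p2 a b eab.
have nab : `|a| = `|b|.
  apply: (@powR_injective _ (p - 1)); rewrite ?nnegrE//; first lra.
  by rewrite -!normr_spow// eab.
have [a0|a0] := eqVneq a 0.
  by move: nab; rewrite a0 normr0 => /esym/eqP; rewrite normr_eq0 => /eqP.
move: eab; rewrite /spow nab => /mulIf; apply.
by rewrite gt_eqF// powR_gt0// -nab normr_gt0.
Qed.

Lemma spow_tangent p a b : 2 <= p ->
  p * spow p a * (b - a) <= `|b| `^ p - `|a| `^ p.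
Proof.
move=> p2; have := @powR_tangent p `|a| `|b| _ (normr_ge0 _) (normr_ge0 _).
move=> /(_ ltac:(lra)); apply: le_trans.
rewrite -[leLHS]mulrA -[leRHS]mulrA ler_pM2l; last lra.
rewrite !mulrBr mulr_spow// [X in _ <= _ - X]mulrC mulr_powRB1//; last lra.
by rewrite lerD2r -normr_spow// -normrM ler_norm.
Qed.

Lemma spow_lipschitz p M a b : 2 <= p -> `|a| <= M -> `|b| <= M ->
  `|spow p a - spow p b| <= (p - 1) * M `^ (p - 2) * `|a - b|.
Proof.
move=> p2; wlog ab : a b / b <= a.
  move=> H aM bM; have [ab|/ltW ab] := leP b a; first exact: H.
  by rewrite distrC (distrC a) H.
wlog a0 : a b ab / 0 <= a.
  move=> H aM bM; have [a0|/ltW a0] := leP 0 a; first exact: H.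
  have e x y : - x - - y = y - x :> R by ring.
  by have := H (- b) (- a); rewrite !spowN !e !normrN; apply; lra.
move=> aM bM.
have M0 : 0 <= M by apply: le_trans aM.
have bnd t : `|t| <= M -> `|t| `^ (p - 2) <= M `^ (p - 2).
  by move=> tM; apply: ge0_ler_powR; rewrite ?nnegrE//; lra.
have mM := powR_ge0 M (p - 2).
rewrite (ger0_norm (_ : 0 <= a - b)); last by rewrite subr_ge0.
(* For equal signs the tangent inequality with exponent p - 1 >= 1 applies; for opposite signs [a]
   and [- b] are estimated separately. *)
have [b0|/ltW b0] := leP 0 b.
  rewrite !ge0_spow//.
  have := @powR_tangent (p - 1) a b ltac:(lra) a0 b0.
  have -> : p - 1 - 1 = p - 2 by ring.
  have : b `^ (p - 1) <= a `^ (p - 1).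
    by apply: ge0_ler_powR; rewrite ?nnegrE//; lra.
  move=> h1 h2; rewrite ger0_norm ?subr_ge0//.
  have := bnd _ aM; rewrite (ger0_norm a0) => h3.
  have : (p - 1) * (a - b) * a `^ (p - 2) <= (p - 1) * (a - b) * M `^ (p - 2).
    by rewrite ler_wpM2l// mulr_ge0//; lra.
  lra.
have h1 := bnd _ aM; have h2 := bnd _ bM.
rewrite /spow ger0_norm; last first.
  by rewrite -mulNr addr_ge0// mulr_ge0 ?powR_ge0//; lra.
have : a * `|a| `^ (p - 2) <= a * M `^ (p - 2) by rewrite ler_wpM2l.
have : (- b) * `|b| `^ (p - 2) <= (- b) * M `^ (p - 2) by rewrite ler_wpM2l//; lra.
have : 0 <= (p - 2) * (M `^ (p - 2) * (a - b)).
  by rewrite !mulr_ge0//; lra.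
lra.
Qed.

(** Convexity makes the remainder nonnegative; the tangent inequality at [b] bounds it by p (spow b
    - spow a) (b - a), which is quadratic since [spow] is Lipschitz. *)
Lemma powR_norm_taylor p M a b : 2 <= p -> `|a| <= M -> `|b| <= M ->
  `| `|b| `^ p - `|a| `^ p - p * spow p a * (b - a)| <=
  p * (p - 1) * M `^ (p - 2) * `|b - a| ^+ 2.
Proof.
move=> p2 aM bM.
have h1 := spow_tangent p a b p2; have h2 := spow_tangent p b a p2.
have h3 := spow_lipschitz p M b a p2 bM aM.
rewrite ger0_norm; last by rewrite subr_ge0.
have : (spow p b - spow p a) * (b - a) <=
    (p - 1) * M `^ (p - 2) * `|b - a| * `|b - a|.
  by rewrite (le_trans (ler_norm _))// normrM ler_wpM2r.
have p0 : 0 <= p by lra.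
move=> /(ler_wpM2l p0); rewrite expr2; lra.
Qed.

End SignedPower.

(** * Functions of class C^{1,1} on the plane *)

Section Calculus.
Context {R : realType}.

Lemma itv_segment (i : interval R) a b z : a \in i -> b \in i ->
  z \in `[a, b] -> z \in i.
Proof.
move=> ai bi; rewrite in_itv/= => zab.
by have := @interval_is_interval _ i a b; apply.
Qed.

Lemma derive_bound_lipschitz (f df : R -> R) (i : interval R) K :
  (forall z, z \in i -> is_derive z 1 f (df z)) ->
  (forall z, z \in i -> `|df z| <= K) ->
  forall a b, a \in i -> b \in i -> `|f a - f b| <= K * `|a - b|.
Proof.
move=> dfi dfK; suff H a b : a \in i -> b \in i -> a <= b ->
    `|f b - f a| <= K * `|b - a|.
  move=> a b ai bi; have [ab|/ltW ba] := leP a b; last exact: H.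
  by rewrite distrC (distrC a) H.
move=> ai bi ab; have sub := itv_segment i a b _ ai bi.
have [||c cab ->] := @MVT_segment _ f df a b ab.
- by move=> z zab; apply/dfi/sub/subset_itv_oo_cc.
- apply: derivable_within_continuous => z zab.
  by have [] := dfi z (sub _ zab).
by rewrite normrM ler_wpM2r// dfK// sub.
Qed.

(** A quadratic remainder is little-o of the increment. The space is left general because both the
    line and the plane occur. *)
Lemma is_diff_quadratic (V : normedModType R) (f : V -> R)
    (df : {linear V -> R}) (x : V) C :
  continuous df ->
  (\forall y \near x, `|f y - f x - df (y - x)| <= C * `|y - x| ^+ 2) ->
  is_diff x f df.
Proof.
move=> cdf fC.
have H : f \o shift x = cst (f x) + df +o_ 0 id.
  apply/eqaddoP => _/posnumP[e]; near=> h.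
  have -> : (f \o shift x - (cst (f x) + df : V -> R)) h =
      f (h + x) - f x - df (h + x - x).
    by rewrite addrK !fctE /= opprD addrA.
  apply: (@le_trans _ _ (C * `|h + x - x| ^+ 2)).
    near: h; have := fC; rewrite (near_shift 0) /=; apply: filterS => h.
    by rewrite subr0.
  rewrite addrK expr2 mulrA ler_wpM2r//.
  apply: (@le_trans _ _ (`|C| * `|h|)); first by rewrite ler_wpM2r// ler_norm.
  have C1 : 0 < `|C| + 1 by rewrite ltr_pwDr.
  apply: (@le_trans _ _ ((`|C| + 1) * `|h|)).
    by rewrite ler_wpM2r// lerDl.
  by rewrite mulrC -ler_pdivlMr// ltW//; near: h; apply: nbhs0_lt.
have E := diff_unique cdf H.
by apply: DiffDef => //; apply/diff_locallyP; rewrite E.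
Unshelve. all: by end_near. Qed.

Definition dot2 (v h : R * R) : R := v.1 * h.1 + v.2 * h.2.

Lemma dot2_is_linear v : linear (dot2 v).
Proof. by move=> a h k; rewrite /dot2 /= /GRing.scale /=; ring. Qed.

HB.instance Definition _ v :=
  GRing.isLinear.Build R (R * R)%type R _ (dot2 v) (dot2_is_linear v).

Lemma normr_fst (x : R * R) : `|x.1| <= `|x|.
Proof. by rewrite prod_normE le_max lexx. Qed.

Lemma normr_snd (x : R * R) : `|x.2| <= `|x|.
Proof. by rewrite prod_normE le_max lexx orbT. Qed.

(** The factor 2 arises because the norm on the plane is the maximum norm. *)
Lemma normr_dot2 v h : `|dot2 v h| <= 2 * `|v| * `|h|.
Proof.
rewrite /dot2 (le_trans (ler_normD _ _))// !normrM.
by have := ler_pM (normr_ge0 _) (normr_ge0 _) (normr_fst v) (normr_fst h);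
  have := ler_pM (normr_ge0 _) (normr_ge0 _) (normr_snd v) (normr_snd h); lra.
Qed.

Lemma dot2_continuous v : continuous (dot2 v).
Proof.
by move=> x; apply: cvgD; (apply: cvgM; first exact: cvg_cst);
  [exact: cvg_fst | exact: cvg_snd].
Qed.

Lemma dot2B v w h : dot2 v h - dot2 w h = dot2 (v - w) h.
Proof. by rewrite /dot2 /=; ring. Qed.

(* A function whose values on [A] are given, up to a uniform quadratic error,
   by a first-order expansion with Lipschitz gradient. *)
Definition C11_expansion (A : set (R * R)) (f : R * R -> R)
    (v : R * R -> R * R) (C : R) :=
  forall x y, A x -> A y ->
    `|f y - f x - dot2 (v x) (y - x)| <= C * `|y - x| ^+ 2 /\
    `|v x - v y| <= C * `|x - y|.

Lemma C11_is_diff (A : set (R * R)) (f : R * R -> R) (df : R * R -> R * R -> R) L :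
  (forall x, A x -> is_diff x f (df x)) ->
  (forall x y h, A x -> A y -> `|df x h - df y h| <= L * `|x - y| * `|h|) ->
  C11 A f.
Proof.
move=> dfA dfL; split; first by move=> x /dfA[].
exists L => x y h Ax Ay; apply: le_trans (dfL x y h Ax Ay).
have [_ /(congr1 (@^~ h)) Ex] := dfA x Ax.
have [_ /(congr1 (@^~ h)) Ey] := dfA y Ay.
rewrite le_eqVlt; apply/orP; left; apply/eqP.
exact: (congr1 (fun a : R => `|a|) (f_equal2 (fun a b : R => a - b) Ex Ey)).
Qed.

(** Since r - 1 <= 0, the derivative r z^(r-1) is largest in absolute value at the left end [lo]. *)
Lemma powR_ge_lipschitz (r lo a b : R) : 0 < lo -> lo <= a -> lo <= b -> r <= 1 ->
  `|a `^ r - b `^ r| <= `|r| * lo `^ (r - 1) * `|a - b|.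
Proof.
move=> lo0 la lb r1.
have pos z : z \in `[lo, +oo[ -> 0 < z.
  by rewrite in_itv/= andbT; exact: lt_le_trans.
have := derive_bound_lipschitz (@powR R ^~ r) (fun z => r * z `^ (r - 1)) `[lo, +oo[.
apply; rewrite ?in_itv/= ?andbT//.
- by move=> z /pos z0; exact: is_derive1_powR.
- move=> z zlo; rewrite normrM ler_wpM2l// ger0_norm ?powR_ge0//.
  rewrite -(opprB 1 r) !powRN lef_pV2 ?posrE ?powR_gt0//; last exact: pos.
  have z0 := pos z zlo; move: zlo; rewrite in_itv/= andbT => zlo.
  by apply: ge0_ler_powR; rewrite ?nnegrE; lra.
Qed.

(** By the chain rule the gradient is r f^(r-1) v, and the lower bound [lo] keeps [f] away from the
    singularity of the power at 0. This serves to pass from the p-th power of the distance to the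
    distance. *)
Lemma C11_expansion_powR (A : set (R * R)) f v C (r lo M : R) : open A ->
  C11_expansion A f v C -> 0 < lo -> r <= 1 ->
  (forall x, A x -> lo <= f x /\ `|v x| <= M) ->
  (forall x y, A x -> A y -> `|f x - f y| <= M * `|x - y|) ->
  C11 A (fun x => f x `^ r).
Proof.
move=> oA fv lo0 r1 fM fL.
have dfx x : A x -> is_diff x f (dot2 (v x)).
  move=> Ax; apply: (@is_diff_quadratic _ f _ x C (dot2_continuous (v x))).
  have := open_nbhs_nbhs (conj oA Ax); apply: filterS => y Ay.
  by have [] := fv x y Ax Ay.
have dpow x : A x -> is_derive (f x) 1 (@powR R ^~ r) (r * f x `^ (r - 1)).
  by move=> Ax; apply: is_derive1_powR; have [/(lt_le_trans lo0)] := fM x Ax.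
have dpf x : A x -> is_diff x (fun x => f x `^ r)
    (fun h => r * f x `^ (r - 1) * dot2 (v x) h).
  move=> Ax; have Dx := dpow x Ax.
  have D1 : differentiable (@powR R ^~ r) (f x).
    by apply/derivable1_diffP; apply: ex_derive.
  have D2 : is_diff (f x) (@powR R ^~ r) (fun h : R => h * (r * f x `^ (r - 1))).
    apply: DiffDef => //; rewrite (diff1E D1); apply/funext => h.
    by rewrite derive1E derive_val.
  have D3 := dfx x Ax.
  have := is_diff_comp D3 D2.
  by congr is_diff_def; apply/funext => h /=; rewrite mulrC.
(* The two summands account for the variation of [v] and that of f^(r-1); the factor 2 is that of
   [normr_dot2]. *)
apply: (C11_is_diff A _ _
  (2 * (`|r| * lo `^ (r - 1) * C + `|r| * (`|r - 1| * lo `^ (r - 1 - 1)) * M * M)) dpf).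
move=> x y h Ax Ay.
have [fx vx] := fM x Ax; have [fy vy] := fM y Ay.
have -> : r * f x `^ (r - 1) * dot2 (v x) h - r * f y `^ (r - 1) * dot2 (v y) h =
  r * f x `^ (r - 1) * dot2 (v x - v y) h +
  r * (f x `^ (r - 1) - f y `^ (r - 1)) * dot2 (v y) h.
  by rewrite -dot2B; ring.
rewrite (le_trans (ler_normD _ _))// !normrM.
have -> t s : 2 * (t + s) * `|x - y| * `|h| =
  2 * t * `|x - y| * `|h| + 2 * s * `|x - y| * `|h| by ring.
have [_ vL] := fv x y Ax Ay.
have p1 := powR_ge_lipschitz (r - 1) lo _ _ lo0 fx fy ltac:(lra).
have p2 : `|f x `^ (r - 1)| <= lo `^ (r - 1).
  rewrite ger0_norm ?powR_ge0// -(opprB 1 r) !powRN.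
  rewrite lef_pV2 ?posrE ?powR_gt0// ?(lt_le_trans lo0)//.
  by apply: ge0_ler_powR; rewrite ?nnegrE; lra.
have d1 := normr_dot2 (v x - v y) h; have d2 := normr_dot2 (v y) h.
apply: lerD.
- rewrite [leRHS](_ : _ = `|r| * (lo `^ (r - 1) * (2 * (C * `|x - y|) * `|h|)));
    last by ring.
  rewrite -mulrA ler_wpM2l//; apply: ler_pM => //; apply: (le_trans d1).
  by rewrite ler_wpM2r// ler_wpM2l.
- have M0 : 0 <= M by apply: le_trans vx.
  rewrite [leRHS](_ : _ = `|r| * (`|r - 1| * lo `^ (r - 1 - 1) * (M * `|x - y|) *
    (2 * M * `|h|))); last by ring.
  rewrite -mulrA ler_wpM2l//; apply: ler_pM => //.
  + by apply: (le_trans p1); rewrite ler_wpM2l ?mulr_ge0 ?powR_ge0// fL.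
  + by apply: (le_trans d2); rewrite ler_wpM2r// ler_wpM2l.
Qed.

End Calculus.

(** * Local regularity of real functions *)

Section LocalRegularity.
Context {R : realType}.

Definition locally_lipschitz (f : R -> R) a := exists L, exists2 r, 0 < r &
  forall x y, `|x - a| < r -> `|y - a| < r -> `|f x - f y| <= L * `|x - y|.

Lemma near_ball_ex (P : R -> Prop) a : (\forall x \near a, P x) <->
  exists2 r, 0 < r & forall x, `|x - a| < r -> P x.
Proof.
split=> [/nbhs_ballP[r /= r0 H]|[r r0 H]].
  by exists r => // x xa; apply: H; rewrite /ball/= distrC.
by apply/nbhs_ballP; exists r => //= x; rewrite /ball/= distrC; exact: H.
Qed.

Lemma locally_lipschitz_near_eq f g a : (\forall x \near a, f x = g x) ->
  locally_lipschitz f a -> locally_lipschitz g a.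
Proof.
move=> /near_ball_ex[r1 r10 H] [L [r r0 fL]]; exists L.
exists (Num.min r1 r); first by rewrite lt_min r10.
by move=> x y; rewrite !lt_min => /andP[? ?] /andP[? ?]; rewrite -!H// fL.
Qed.

(** Continuity at [a] bounds the derivative by |df a| + 1 nearby, and the mean value theorem
    concludes. *)
Lemma locally_lipschitz_of_derive (f df : R -> R) (a : R) :
  (\forall x \near a, is_derive (x : R) 1 f (df x)) -> {for a, continuous df} ->
  locally_lipschitz f a.
Proof.
move=> dfa cdf.
have : \forall x \near a, is_derive (x : R) 1 f (df x) /\ `|df x| <= `|df a| + 1.
  near=> x; split; first by near: x.
  rewrite -lerBlDl (le_trans (lerB_dist _ _))// distrC.
  by near: x; move/cvgrPdist_le: cdf; exact.
move=> /near_ball_ex[r r0 H]; exists (`|df a| + 1), r => // x y xa ya.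
have inI z : (z \in `]a - r, a + r[) = (`|z - a| < r).
  by rewrite in_itv/= ltr_distl.
apply: (@derive_bound_lipschitz _ f df `]a - r, a + r[); rewrite ?inI//.
- by move=> z; rewrite inI => /H[].
- by move=> z; rewrite inI => /H[].
Unshelve. all: by end_near. Qed.

Lemma locally_lipschitz_comp (f g : R -> R) a :
  locally_lipschitz f a -> locally_lipschitz g (f a) ->
  locally_lipschitz (g \o f) a.
Proof.
move=> [L [r r0 fL]] [K [s s0 gK]].
(* The radius makes [f] send the ball around [a] into the ball of radius [s] around [f a]; the added
   1 keeps the denominator positive. *)
exists (`|K| * L), (Num.min r (s / (`|L| + 1))).
  by rewrite lt_min r0 divr_gt0// ltr_pwDr.
have inb x : `|x - a| < Num.min r (s / (`|L| + 1)) -> `|x - a| < r /\ `|f x - f a| < s.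
  rewrite lt_min => /andP[xr xs]; split => //.
  apply: (le_lt_trans (fL x a xr _)); first by rewrite subrr normr0.
  move: xs; rewrite ltr_pdivlMr ?ltr_pwDr// mulrDr mulr1 => xs.
  have h1 : L * `|x - a| <= `|L| * `|x - a| by rewrite ler_wpM2r// ler_norm.
  have h2 := normr_ge0 (x - a); lra.
move=> x y /inb[xr xs] /inb[yr ys]; apply: (le_trans (gK _ _ xs ys)).
apply: (@le_trans _ _ (`|K| * `|f x - f y|)).
  by rewrite ler_wpM2r// ler_norm.
by rewrite -mulrA ler_wpM2l// fL.
Qed.

(** The common regularity to which both the Hoelder arcs and the analytic arcs are reduced. *)
Definition C11_at (f : R -> R) (a : R) :=
  (\forall x \near a, derivable f (x : R) 1) /\ locally_lipschitz f^`()%classic a.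

Lemma C11_at_derive2 (f f1 f2 : R -> R) (a : R) :
  (\forall x \near a, is_derive (x : R) 1 f (f1 x)) ->
  (\forall x \near a, is_derive (x : R) 1 f1 (f2 x)) -> {for a, continuous f2} ->
  C11_at f a.
Proof.
move=> ff1 f12 cf2; split; first by apply: filterS ff1 => x [].
apply: (locally_lipschitz_near_eq f1); last exact: locally_lipschitz_of_derive f12 cf2.
by apply: filterS ff1 => x fx; rewrite derive1E derive_val.
Qed.

(** With k >= 3 the second derivative is itself differentiable, hence continuous, so the first
    derivative is locally Lipschitz. *)
Lemma CkHolder_C11_at k al (A : set R) f (a : R) : (3 <= k)%N -> open A -> A a ->
  CkHolder k al A f -> C11_at f a.
Proof.
move=> k3 oA Aa [df _].
have nA := open_nbhs_nbhs (conj oA Aa).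
apply: (@C11_at_derive2 f f^`()%classic f^`(2)%classic).
- apply: filterS nA => x Ax; rewrite derive1E.
  by apply/derivableP/(df 0%N) => //; exact: leq_trans k3.
- apply: filterS nA => x Ax; rewrite derive1nS derive1n1 derive1E.
  by apply/derivableP; rewrite -derive1n1; apply: df => //; exact: leq_trans k3.
- by apply/differentiable_continuous/derivable1_diffP/df.
Qed.

(** The terms c_n K^n are bounded, and at K/4 differentiation brings in only the factor (n+1)/4^n <=
    2^(-n), so a geometric series dominates. *)
Lemma is_cvg_pseries_diffs (c : nat -> R) (K : R) : 0 < K ->
  cvgn (pseries c K) -> cvgn (pseries (pseries_diffs c) (K / 4)).
Proof.
move=> K0 cK; have [B [_ HB]] := cvg_series_bounded cK.
have {}HB n : `|c n * K ^+ n| <= `|B + 1|.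
  by apply: (le_trans (HB (B + 1) _ n I)); rewrite ?ltrDl// ler_norm.
apply: normed_cvg.
apply: (@series_le_cvg _ _ (geometric (`|B + 1| / K) 2^-1)).
- by move=> n /=; rewrite normr_ge0.
- by move=> n /=; rewrite mulr_ge0// ?divr_ge0// ltW.
- move=> n /=.
  have -> : pseries_diffs c n * (K / 4) ^+ n =
      c n.+1 * K ^+ n.+1 * (K^-1 * (n.+1%:R / 4 ^+ n)).
    rewrite /pseries_diffs exprMn exprVn exprS; field.
    by rewrite gt_eqF//= gt_eqF// exprn_gt0.
  rewrite normrM -[leRHS]mulrA; apply: ler_pM => //.
  rewrite ger0_norm; last by rewrite mulr_ge0 ?invr_ge0 ?divr_ge0 ?exprn_ge0 ?ltW.
  rewrite ler_pM2l ?invr_gt0// ler_pdivrMr ?exprn_gt0//.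
  rewrite -exprMn (_ : 2^-1 * 4 = 2 :> R); last by field.
  by rewrite -natrX ler_nat ltn_expl.
- apply: is_cvg_geometric_series; rewrite ger0_norm ?invr_ge0//.
  by rewrite invf_lt1// ltr1n.
Qed.

(** Termwise differentiation is applied with convergence of the series and of its first two formal
    derivatives; each derivative costs a factor 4, whence K/16. *)
Lemma is_derive_pseries (c : nat -> R) (K : R) : 0 < K -> cvgn (pseries c K) ->
  forall z : R, `|z| < K / 16 -> is_derive z 1 (fun z => limn (pseries c z))
    (limn (pseries (pseries_diffs c) z)).
Proof.
move=> K0 cK z zK.
have c1 := is_cvg_pseries_diffs c K K0 cK.
have K4 : 0 < K / 4 by rewrite divr_gt0.
have c2 := is_cvg_pseries_diffs _ _ K4 c1.
have K16 : K / 4 / 4 = K / 16 by field.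
rewrite K16 in c2.
have K160 : 0 < K / 16 by rewrite divr_gt0.
apply: (@pseries_snd_diffs _ c (K / 16)) => //.
- apply: (is_cvg_pseries_inside cK); rewrite !gtr0_norm//; lra.
- apply: (is_cvg_pseries_inside c1); rewrite !gtr0_norm//; lra.
- by rewrite (gtr0_norm K160).
Qed.

(** The power series is differentiated termwise; the second derivative is continuous because its own
    series is differentiable at [a]. Everything starts from convergence at r/2, inside the given
    radius. *)
Lemma analytic_C11_at (f : R -> R) (a : R) : analytic_at f a -> C11_at f a.
Proof.
move=> [r [u [r0 fu]]].
have hr : 0 < r / 2 by rewrite divr_gt0.
have fE y : `|y - a| < r -> f y = limn (pseries u (y - a)).
  by move=> /fu /cvg_lim => /(_ (@norm_hausdorff _ _)) <-.
have c0 : cvgn (pseries u (r / 2)).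
  have := fu (a + r / 2); rewrite addrC addKr => H; apply/cvg_ex; eexists.
  by apply: H; rewrite gtr0_norm//; lra.
have step c K : 0 < K -> cvgn (pseries c K) -> \forall y \near a,
    is_derive (y : R) 1 (fun y : R => limn (pseries c (y - a)))
      (limn (pseries (pseries_diffs c) (y - a))).
  move=> K0 cK; apply/near_ball_ex; exists (K / 16); first by rewrite divr_gt0.
  move=> y ya; have D := is_derive_pseries c K K0 cK _ ya.
  have D' : is_derive y 1 (fun y : R => y - a) 1 by apply: is_derive_shift.
  have := @is_derive1_comp _ (fun z => limn (pseries c z)) (fun y => y - a) y _ _ D D'.
  by rewrite mulr1.
have c1 := is_cvg_pseries_diffs _ _ hr c0.
have hr4 : 0 < r / 2 / 4 by rewrite divr_gt0.
have c2 := is_cvg_pseries_diffs _ _ hr4 c1.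
have hr16 : 0 < r / 2 / 4 / 4 by rewrite divr_gt0.
apply: (@C11_at_derive2 f (fun y => limn (pseries (pseries_diffs u) (y - a)))
   (fun y => limn (pseries (pseries_diffs (pseries_diffs u)) (y - a)))).
- have E : \forall y \near a, limn (pseries u (y - a)) = f y.
    by apply/near_ball_ex; exists r => // y /fE.
  (* Differentiating at [y] requires [f] to agree with the series on a whole neighborhood of [y],
     which [near_join] supplies. *)
  by apply: filterS2 (near_join E) (step _ _ hr c0) => y; exact: near_eq_is_derive.
- exact: step hr4 c1.
- apply/differentiable_continuous/derivable1_diffP.
  by have [] := nbhs_singleton (step _ _ hr16 c2).
Qed.

End LocalRegularity.

(** * Nearest points *)

Section NearestPoint.
Context {R : realType}.
Implicit Types (p : R) (x y z : R * R) (B : set (R * R)).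

(** The p-th power of [gammap]: it has the same minimizers and, for p >= 2, remains of class C^{1,1}
    near the origin. *)
Definition powsum p x : R := `|x.1| `^ p + `|x.2| `^ p.

Definition nearest p B x y := B y /\
  forall z, B z -> powsum p (x - y) <= powsum p (x - z).

Lemma normr_prod_le x M : (`|x| <= M) = (`|x.1| <= M) && (`|x.2| <= M).
Proof. by rewrite prod_normE ge_max. Qed.

Lemma powsum_ge p x : 0 <= p -> `|x| `^ p <= powsum p x.
Proof.
move=> p0; rewrite /powsum prod_normE /Num.max; case: ifP => _.
  by rewrite lerDr powR_ge0.
by rewrite lerDl powR_ge0.
Qed.

Lemma powsum_le p x : 1 <= p -> powsum p x <= (2 * `|x|) `^ p.
Proof.
move=> p1; apply: le_trans (le1r_powRZ _ _ _) => //; last lra.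
have le1 (t : R) : `|t| <= `|x| -> `|t| `^ p <= `|x| `^ p.
  by move=> tx; apply: ge0_ler_powR; rewrite ?nnegrE//; lra.
by have := le1 _ (normr_fst x); have := le1 _ (normr_snd x); rewrite /powsum; lra.
Qed.

(** The p-norm lies between the maximum norm and twice it. Hence points close to a boundary point
    [y0] have their nearest points close to [y0]. *)
Lemma nearest_norm_le p B x y y0 : 1 <= p -> B y0 -> nearest p B x y ->
  `|x - y| <= 2 * `|x - y0|.
Proof.
move=> p1 By0 [_ /(_ _ By0)] xy; have p0 : 0 < p by lra.
rewrite leNgt; apply/negP => lt2.
have := gt0_ltr_powR p0 _ _ lt2; rewrite !nnegrE => /(_ _ _) h.
have {}h := h ltac:(by rewrite mulr_ge0) ltac:(by []).
have := lt_le_trans h (powsum_ge _ (x - y) (ltW p0)).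
by move=> /lt_le_trans /(_ (le_trans xy (powsum_le _ _ p1))); rewrite ltxx.
Qed.

(** The quadratic bound of [powR_norm_taylor] treats all [t] alike, including 0, where the absolute
    value is not differentiable. *)
Lemma is_derive_powR_norm p (t : R) : 2 <= p ->
  is_derive t 1 (fun t => `|t| `^ p) (p * spow p t).
Proof.
move=> p2.
have D : is_diff t (fun t : R => `|t| `^ p) ( *:%R (p * spow p t) : R -> R).
  apply: (@is_diff_quadratic R R _ ( *:%R (p * spow p t) : {linear R -> R}) t
    (p * (p - 1) * (`|t| + 1) `^ (p - 2))).
    exact: scaler_continuous.
  near=> y; apply: powR_norm_taylor => //; first by rewrite lerDl.
  have : `|t - y| <= 1 by near: y; apply: cvgr_dist_le.
  by rewrite distrC; have := lerB_dist y t; lra.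
have D1 : differentiable (fun t : R => `|t| `^ p) t by [].
apply: DeriveDef; first exact/derivable1_diffP.
by rewrite -derive1E derive1E'// diff_val [_ *: _]mulr1.
Unshelve. all: by end_near. Qed.

End NearestPoint.

(** * The dual normal field and the first-order condition at nearest points *)

Section NormalField.
Context {R : realType}.
Implicit Types (p : R) (B : set (R * R)).

Lemma locally_lipschitz_continuous (f : R -> R) a :
  locally_lipschitz f a -> {for a, continuous f}.
Proof.
move=> [L [r r0 fL]]; apply/cvgrPdist_le => e e0.
apply/near_ball_ex; exists (Num.min r (e / (`|L| + 1))).
  by rewrite lt_min r0 divr_gt0// ltr_pwDr.
move=> x; rewrite lt_min ltr_pdivlMr ?ltr_pwDr// => /andP[xr xe].
rewrite distrC; apply: (le_trans (fL x a xr _)); first by rewrite subrr normr0.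
apply/ltW/(le_lt_trans _ xe); rewrite mulrC ler_wpM2l//.
by rewrite (le_trans (ler_norm L))// lerDl.
Qed.

Lemma mean_value_ball (f : R -> R) (a r s t : R) :
  (forall z, `|z - a| < r -> derivable f z 1) -> `|s - a| < r -> `|t - a| < r ->
  exists2 z, `|z - a| < r & f s - f t = f^`()%classic z * (s - t).
Proof.
move=> df; wlog st : s t / t <= s.
  move=> H sr tr; have [st|/ltW st] := leP t s; first exact: H.
  have [z zr Ez] := H t s st tr sr; exists z => //.
  by rewrite -opprB Ez -mulrN opprB.
move=> sr tr.
have sub z : z \in `[t, s] -> `|z - a| < r.
  by move: sr tr; rewrite in_itv/= !ltr_distl => /andP[? ?] /andP[? ?] /andP[? ?]; lra.
have [||z zst ->] := @MVT_segment _ f f^`()%classic t s st.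
- move=> z /subset_itv_oo_cc /sub zr; rewrite derive1E.
  exact/derivableP/df.
- by apply: derivable_within_continuous => z /sub/df.
by exists z => //; exact: sub.
Qed.

(* [(n1 t, n2 t)] is parallel to [x - (u t, v t)] whenever [(u t, v t)] is a point
   of the curve nearest to [x]: it is the dual, for the p-norm, of the Euclidean
   normal to the curve. *)
Definition p_normal_field p (u v n1 n2 : R -> R) (t0 : R) :=
  [/\ locally_lipschitz n1 t0, locally_lipschitz n2 t0,
    n1 t0 != 0 \/ n2 t0 != 0 &
    \forall t \near t0,
      spow p (n1 t) * u^`()%classic t + spow p (n2 t) * v^`()%classic t = 0].

(** If the cross product vanished, (u', v') would solve a homogeneous linear system whose
    determinant is |n1|^p + |n2|^p > 0, contradicting that the tangent is nonzero. *)
Lemma p_normal_transversal p u v n1 n2 t0 : 2 <= p ->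
  p_normal_field p u v n1 n2 t0 ->
  u^`()%classic t0 != 0 \/ v^`()%classic t0 != 0 ->
  v^`()%classic t0 * n1 t0 - u^`()%classic t0 * n2 t0 != 0.
Proof.
move=> p2 [_ _ n0 /nbhs_singleton]; set u' := u^`()%classic t0.
set v' := v^`()%classic t0; set a := n1 t0; set b := n2 t0 => H uv0.
apply/eqP => q0.
have pos : 0 < `|a| `^ p + `|b| `^ p.
  have := powR_ge0 `|a| p; have := powR_ge0 `|b| p.
  by case: n0 => n0; [have := @powR_gt0 _ `|a| p|have := @powR_gt0 _ `|b| p];
    rewrite normr_gt0 => /(_ n0); lra.
have E1 : v' * (`|a| `^ p + `|b| `^ p) = 0.
  rewrite -!mulr_spow//.
  transitivity ((spow p a * u' + spow p b * v') * b
     + spow p a * (v' * a - u' * b)); first by ring.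
  by rewrite H q0 mul0r mulr0 addr0.
have E2 : u' * (`|a| `^ p + `|b| `^ p) = 0.
  rewrite -!mulr_spow//.
  transitivity ((spow p a * u' + spow p b * v') * a
     - spow p b * (v' * a - u' * b)); first by ring.
  by rewrite H q0 mul0r mulr0 subr0.
move: E1 E2 => /eqP + /eqP; rewrite !mulf_eq0 (gt_eqF pos) !orbF.
by move=> /eqP v0 /eqP u0; case: uv0 => /eqP.
Qed.

(** The p-th power of the distance from (x1, x2) to the curve has an interior minimum at [t], so its
    derivative vanishes there. *)
Lemma nearest_first_order p B (u v : R -> R) (t0 r t x1 x2 : R) : 2 <= p ->
  (forall s, `|s - t0| < r -> [/\ B (u s, v s), derivable u s 1 & derivable v s 1]) ->
  `|t - t0| < r -> nearest p B (x1, x2) (u t, v t) ->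
  spow p (x1 - u t) * u^`()%classic t + spow p (x2 - v t) * v^`()%classic t = 0.
Proof.
move=> p2 H tr [_ tmin].
pose F s := `|x1 - u s| `^ p + `|x2 - v s| `^ p.
have DF s : `|s - t0| < r -> is_derive s 1 F
    (p * spow p (x1 - u s) * - u^`()%classic s + p * spow p (x2 - v s) * - v^`()%classic s).
  move=> /H[_ du dv].
  have D1 : is_derive s 1 (fun s => x1 - u s) (- u^`()%classic s).
    rewrite derive1E -[X in is_derive _ _ _ X]add0r.
    by apply: is_deriveB; exact: derivableP.
  have D2 : is_derive s 1 (fun s => x2 - v s) (- v^`()%classic s).
    rewrite derive1E -[X in is_derive _ _ _ X]add0r.
    by apply: is_deriveB; exact: derivableP.
  have E1 := is_derive_powR_norm p (x1 - u s) p2.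
  have E2 := is_derive_powR_norm p (x2 - v s) p2.
  have C1 := @is_derive1_comp R (fun t : R => `|t| `^ p) (fun s => x1 - u s) s _ _ E1 D1.
  have C2 := @is_derive1_comp R (fun t : R => `|t| `^ p) (fun s => x2 - v s) s _ _ E2 D2.
  exact: (is_deriveD C1 C2).
have inI s : (s \in `]t0 - r, t0 + r[) = (`|s - t0| < r) by rewrite in_itv/= ltr_distl.
have r0 : 0 < r by apply: le_lt_trans tr.
have D0 : is_derive t 1 F 0.
  apply: (@derive1_at_min _ _ (t0 - r) (t0 + r)); rewrite ?inI//; first lra.
  - by move=> s; rewrite inI => /DF[].
  - by move=> s; rewrite inI => /H[Bs _ _]; exact: (tmin _ Bs).
have := DF _ tr => -[_]; rewrite (@derive_val _ _ _ _ _ _ _ D0) => E.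
have p0 : p != 0 by rewrite gt_eqF//; lra.
apply: (mulfI p0); rewrite mulr0; lra.
Qed.

(** The images under [spow] of [x - g t] and of the field are both orthogonal to the nonzero
    tangent, hence proportional; [spow] is multiplicative and injective, so the vectors themselves
    are proportional. *)
Lemma nearest_parallel p B (u v n1 n2 : R -> R) (t0 r t x1 x2 : R) : 2 <= p ->
  (forall s, `|s - t0| < r -> [/\ B (u s, v s), derivable u s 1 & derivable v s 1]) ->
  `|t - t0| < r -> nearest p B (x1, x2) (u t, v t) ->
  u^`()%classic t != 0 \/ v^`()%classic t != 0 ->
  spow p (n1 t) * u^`()%classic t + spow p (n2 t) * v^`()%classic t = 0 ->
  (x1 - u t) * n2 t = (x2 - v t) * n1 t.
Proof.
move=> p2 H tr xt uv0 E.
have := nearest_first_order p B u v t0 r t x1 x2 p2 H tr xt.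
set a := x1 - u t; set b := x2 - v t.
move: uv0 E; set u' := u^`()%classic t; set v' := v^`()%classic t => uv0 E F.
apply: (spow_inj p p2); rewrite !spowM; apply/eqP; rewrite -subr_eq0.
have Eu : (spow p a * spow p (n2 t) - spow p b * spow p (n1 t)) * u' = 0.
  transitivity (spow p (n2 t) * (spow p a * u' + spow p b * v')
    - spow p b * (spow p (n1 t) * u' + spow p (n2 t) * v')); first by ring.
  by rewrite E F; ring.
have Ev : (spow p a * spow p (n2 t) - spow p b * spow p (n1 t)) * v' = 0.
  transitivity (spow p a * (spow p (n1 t) * u' + spow p (n2 t) * v')
    - spow p (n1 t) * (spow p a * u' + spow p b * v')); first by ring.
  by rewrite E F; ring.
by move/eqP: Eu; move/eqP: Ev; rewrite !mulf_eq0; case: uv0 => /negPf->;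
  rewrite orbF.
Qed.

(* Points of the curve are recovered from [(x1, x2)] as zeros of
   [t |-> (x1 - u t) * n2 t - (x2 - v t) * n1 t]; by transversality this function
   is strongly monotone near [t0] when [(x1, x2)] is near the curve. *)
Lemma parallel_monotone p (u v n1 n2 : R -> R) (t0 : R) : 2 <= p ->
  C11_at u t0 -> C11_at v t0 ->
  u^`()%classic t0 != 0 \/ v^`()%classic t0 != 0 ->
  p_normal_field p u v n1 n2 t0 ->
  exists2 q, 0 < q & exists2 r, 0 < r & forall s t x1 x2,
    `|s - t0| < r -> `|t - t0| < r ->
    `|x1 - u t| < r -> `|x2 - v t| < r ->
    q * `|s - t| <= `|((x1 - u s) * n2 s - (x2 - v s) * n1 s) -
                      ((x1 - u t) * n2 t - (x2 - v t) * n1 t)|.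
Proof.
move=> p2 [du lu] [dv lv] uv0 nf.
have [l1 l2 _ _] := nf.
pose q := v^`()%classic t0 * n1 t0 - u^`()%classic t0 * n2 t0.
have q0 : q != 0 by exact: p_normal_transversal nf uv0.
have q1 : 0 < `|q| by rewrite normr_gt0.
pose S := `|u^`()%classic t0| + `|v^`()%classic t0| + `|n1 t0| + `|n2 t0| + 2.
have S0 : 0 < S by rewrite ltr_wpDl// !addr_ge0.
(* Up to this deviation from the values at [t0], the two products in the cross product change by at
   most eta S <= |q|/4 in total. *)
pose eta := Num.min 1 (`|q| / (4 * S)).
have eta0 : 0 < eta by rewrite lt_min ltr01 divr_gt0// mulr_gt0.
have etaS : eta * S <= `|q| / 4.
  have : eta <= `|q| / (4 * S) by rewrite ge_min lexx orbT.
  by rewrite ler_pdivlMr ?mulr_gt0// ler_pdivlMr//; lra.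
have eta1 : eta <= 1 by rewrite ge_min lexx.
have near1 (f : R -> R) : locally_lipschitz f t0 ->
    \forall t \near t0, `|f t - f t0| <= eta.
  move=> /locally_lipschitz_continuous /cvgrPdist_le /(_ _ eta0).
  by apply: filterS => t; rewrite distrC.
have [ra ra0 Ha] : exists2 r, 0 < r & forall t, `|t - t0| < r ->
    [/\ `|u^`()%classic t - u^`()%classic t0| <= eta,
        `|v^`()%classic t - v^`()%classic t0| <= eta,
        `|n1 t - n1 t0| <= eta & `|n2 t - n2 t0| <= eta].
  apply/near_ball_ex; near=> t; split; near: t; exact: near1.
have [rb rb0 Hb] : exists2 r, 0 < r & forall t, `|t - t0| < r ->
    derivable u t 1 /\ derivable v t 1.
  by apply/near_ball_ex; exact: filterS2 du dv.
move: l1 l2 => [L1 [r1 r10 l1]] [L2 [r2 r20 l2]].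
pose L := `|L1| + `|L2| + 1.
have L0 : 0 < L by rewrite ltr_wpDl// addr_ge0.
(* The last bound makes (x1, x2) so close to the curve that the variation of the field, weighted by
   this distance, costs at most |q|/4 |s - t|. *)
pose r := Num.min (Num.min ra rb) (Num.min (Num.min r1 r2) (`|q| / (4 * L))).
exists (`|q| / 2); first by rewrite divr_gt0.
exists r; first by rewrite !lt_min ra0 rb0 r10 r20/= divr_gt0// mulr_gt0.
have rP (t : R) : t < r -> [/\ t < ra, t < rb, t < r1, t < r2 & t < `|q| / (4 * L)].
  by rewrite !lt_min => /andP[/andP[? ?] /andP[/andP[? ?] ?]].
move=> s t x1 x2 /rP[sa sb s1 s2 _] /rP[ta tb t1 t2 _] /rP[_ _ _ _ xu] /rP[_ _ _ _ xv].
have [z1 z1a Eu] := mean_value_ball u t0 (Num.min ra rb) s t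
  ltac:(by move=> z; rewrite lt_min => /andP[_ /Hb[]])
  ltac:(by rewrite lt_min sa) ltac:(by rewrite lt_min ta).
have [z2 z2a Ev] := mean_value_ball v t0 (Num.min ra rb) s t
  ltac:(by move=> z; rewrite lt_min => /andP[_ /Hb[]])
  ltac:(by rewrite lt_min sa) ltac:(by rewrite lt_min ta).
have {}z1a : `|z1 - t0| < ra by move: z1a; rewrite lt_min => /andP[].
have {}z2a : `|z2 - t0| < ra by move: z2a; rewrite lt_min => /andP[].
have [Hu _ _ _] := Ha _ z1a; have [_ Hv _ _] := Ha _ z2a.
have [_ _ Hn1 Hn2] := Ha _ sa.
have prod_close (a b a0 b0 : R) : `|a - a0| <= eta -> `|b - b0| <= eta ->
    `|a * b - a0 * b0| <= eta * (`|a0| + `|b0| + 1).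
  move=> aa bb; have -> : a * b - a0 * b0 =
    a0 * (b - b0) + (a - a0) * b0 + (a - a0) * (b - b0) by ring.
  rewrite (le_trans (ler_normD _ _))// [leRHS]mulrDr mulr1; apply: lerD.
    rewrite (le_trans (ler_normD _ _))// [leRHS]mulrDr !normrM; apply: lerD.
      by rewrite mulrC ler_wpM2r.
    by rewrite ler_wpM2r.
  rewrite normrM -[leRHS]mulr1; apply: ler_pM => //.
  exact: le_trans eta1.
(* Cost of replacing the derivatives at the two mean-value points and the field at [s] by their
   values at [t0]. *)
have Q : `|v^`()%classic z2 * n1 s - u^`()%classic z1 * n2 s - q| <= `|q| / 4.
  apply: le_trans etaS.
  have -> : v^`()%classic z2 * n1 s - u^`()%classic z1 * n2 s - q =
    (v^`()%classic z2 * n1 s - v^`()%classic t0 * n1 t0)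
    - (u^`()%classic z1 * n2 s - u^`()%classic t0 * n2 t0) by rewrite /q; ring.
  apply: (le_trans (ler_normB _ _)).
  apply: (le_trans (lerD (prod_close _ _ _ _ Hv Hn1) (prod_close _ _ _ _ Hu Hn2))).
  by rewrite -mulrDr /S ler_pM2l//; clear; lra.
have X : `|(x1 - u t) * (n2 s - n2 t) - (x2 - v t) * (n1 s - n1 t)| <=
    `|q| / 4 * `|s - t|.
  apply: (le_trans (ler_normB _ _)); rewrite !normrM.
  have b1 : `|n1 s - n1 t| <= `|L1| * `|s - t|.
    by apply: (le_trans (l1 _ _ s1 t1)); rewrite ler_wpM2r// ler_norm.
  have b2 : `|n2 s - n2 t| <= `|L2| * `|s - t|.
    by apply: (le_trans (l2 _ _ s2 t2)); rewrite ler_wpM2r// ler_norm.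
  have c2 := ler_pM (normr_ge0 _) (normr_ge0 _) (ltW xu) b2.
  have c1 := ler_pM (normr_ge0 _) (normr_ge0 _) (ltW xv) b1.
  apply: (le_trans (lerD c2 c1)); rewrite -mulrDr -mulrDl mulrA ler_wpM2r//.
  rewrite (_ : `|q| / (4 * L) * (`|L2| + `|L1|) =
    `|q| / 4 * ((`|L2| + `|L1|) / L)); last first.
    by field; rewrite gt_eqF.
  by rewrite ler_piMr ?divr_ge0// ler_pdivrMr// mul1r /L; clear; lra.
(* The increments of the curve give the main term q (s - t); the two errors cost |q|/4 each, which
   leaves the constant |q|/2. *)
have -> : ((x1 - u s) * n2 s - (x2 - v s) * n1 s) -
    ((x1 - u t) * n2 t - (x2 - v t) * n1 t) =
  q * (s - t) + (v^`()%classic z2 * n1 s - u^`()%classic z1 * n2 s - q) * (s - t)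
  + ((x1 - u t) * (n2 s - n2 t) - (x2 - v t) * (n1 s - n1 t)).
  transitivity ((v s - v t) * n1 s - (u s - u t) * n2 s +
    ((x1 - u t) * (n2 s - n2 t) - (x2 - v t) * (n1 s - n1 t))); first by ring.
  by rewrite Eu Ev; ring.
set Z := (X in `|X| <= _) in X *.
set W := _ * n1 s - _ - q in Q *.
have Q' : `|W * (s - t)| <= `|q| / 4 * `|s - t| by rewrite normrM ler_wpM2r.
have h1 := lerB_normD (q * (s - t) + W * (s - t)) Z.
have h2 := lerB_normD (q * (s - t)) (W * (s - t)).
by move: h1 h2 Q' X; rewrite (normrM q); clear; lra.
Unshelve. all: by end_near. Qed.

End NormalField.

(** * Lipschitz dependence of the nearest point and regularity of the distance *)

Section DistanceRegularity.
Context {R : realType}.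
Implicit Types (p : R) (B U : set (R * R)).

Lemma C11_at_lipschitz (f : R -> R) (a : R) : C11_at f a -> locally_lipschitz f a.
Proof.
move=> [df /locally_lipschitz_continuous cf].
apply: (locally_lipschitz_of_derive _ f^`()%classic) => //.
by apply: filterS df => x dfx; rewrite derive1E; exact: derivableP.
Qed.

(** Parameters of nearest points are zeros of the strongly monotone cross product, which depends on
    [x] in a Lipschitz way, so its zeros do too. The last hypothesis on [B] confines the nearest
    points to the curve near [t0]. *)
Lemma nearest_lipschitz p B (u v n1 n2 : R -> R) (t0 : R) : 2 <= p ->
  C11_at u t0 -> C11_at v t0 ->
  u^`()%classic t0 != 0 \/ v^`()%classic t0 != 0 ->
  p_normal_field p u v n1 n2 t0 ->
  (\forall t \near t0, B (u t, v t)) ->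
  (forall d, 0 < d -> exists2 rho, 0 < rho & forall y, B y ->
     `|y - (u t0, v t0)| < rho -> exists2 t, `|t - t0| < d & y = (u t, v t)) ->
  exists K, exists2 e, 0 < e & forall x x' y y',
    `|x - (u t0, v t0)| < e -> `|x' - (u t0, v t0)| < e ->
    nearest p B x y -> nearest p B x' y' -> `|y - y'| <= K * `|x - x'|.
Proof.
move=> p2 Cu Cv uv0 nf nB loc.
have p1 : 1 <= p by lra.
have [q q0 [r r0 mono]] := parallel_monotone p u v n1 n2 t0 p2 Cu Cv uv0 nf.
have [l1 l2 _ nfE] := nf.
have [Lu [ru ru0 lu]] := C11_at_lipschitz _ _ Cu.
have [Lv [rv rv0 lv]] := C11_at_lipschitz _ _ Cv.
have bnd (f : R -> R) : locally_lipschitz f t0 ->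
    \forall t \near t0, `|f t| <= `|f t0| + 1.
  move=> /locally_lipschitz_continuous /cvgrPdist_le /(_ _ ltr01).
  apply: filterS => t; rewrite distrC => h.
  by rewrite -lerBlDl (le_trans (lerB_dist _ _)).
have half (f : R -> R) : locally_lipschitz f t0 ->
    \forall t \near t0, `|f t - f t0| < r / 2.
  move=> /locally_lipschitz_continuous /cvgrPdist_lt.
  by move=> /(_ (r / 2) ltac:(by rewrite divr_gt0)); apply: filterS => t; rewrite distrC.
have nz : \forall t \near t0, u^`()%classic t != 0 \/ v^`()%classic t != 0.
  have nz1 (f : R -> R) : locally_lipschitz f t0 -> f t0 != 0 ->
      \forall t \near t0, f t != 0.
    by by move=> /locally_lipschitz_continuous /cvgr_neq0; apply.
  by case: uv0 => h; [have := nz1 _ (proj2 Cu) h|have := nz1 _ (proj2 Cv) h];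
    apply: filterS => t; [left|right].
pose N := `|n1 t0| + `|n2 t0| + 2.
have [d d0 Hd] : exists2 d, 0 < d & forall t, `|t - t0| < d ->
   [/\ `|t - t0| < r, `|t - t0| < ru, `|t - t0| < rv,
       `|u t - u t0| < r / 2 /\ `|v t - v t0| < r / 2 &
     [/\ B (u t, v t), derivable u t 1 /\ derivable v t 1,
       u^`()%classic t != 0 \/ v^`()%classic t != 0,
       spow p (n1 t) * u^`()%classic t + spow p (n2 t) * v^`()%classic t = 0 &
       `|n1 t| + `|n2 t| <= N]].
  apply/near_ball_ex.
  have ball_near s : 0 < s -> \forall t \near t0, `|t - t0| < s.
    by move=> s0; apply/near_ball_ex; exists s.
  have b1 := bnd _ l1; have b2 := bnd _ l2.
  have h1 := half _ (C11_at_lipschitz _ _ Cu).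
  have h2 := half _ (C11_at_lipschitz _ _ Cv).
  have h12 := filterI h1 h2; have duv := filterI (proj1 Cu) (proj1 Cv).
  near=> t; split; last split.
  - by near: t; exact: ball_near.
  - by near: t; exact: ball_near.
  - by near: t; exact: ball_near.
  - by near: t; exact: h12.
  - by near: t; exact: nB.
  - by near: t; exact: duv.
  - by near: t; exact: nz.
  - by near: t; exact: nfE.
  - rewrite /N (_ : _ + 2 = (`|n1 t0| + 1) + (`|n2 t0| + 1)); last by ring.
    by apply: lerD; near: t.
have [rho rho0 Hrho] := loc d d0.
(* With rho/3, the point [x] and its nearest point, at most twice as far from [x] as the base point
   is, stay within rho; with r/2, [x] is within r of the curve point in each coordinate. *)
exists ((`|Lu| + `|Lv|) * (N / q)), (Num.min (rho / 3) (r / 2)).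
  by rewrite lt_min !divr_gt0.
have locx x y : `|x - (u t0, v t0)| < Num.min (rho / 3) (r / 2) ->
    nearest p B x y -> exists2 t, `|t - t0| < d &
      [/\ y = (u t, v t), (x.1 - u t) * n2 t = (x.2 - v t) * n1 t,
       `|x.1 - u t| < r & `|x.2 - v t| < r].
  rewrite lt_min => /andP[x1 x2] xy.
  have By0 : B (u t0, v t0) by exact: (nbhs_singleton nB).
  have [By _] := xy.
  have [|t td Ey] := Hrho y By.
    have := nearest_norm_le _ _ _ _ _ p1 By0 xy.
    rewrite [X in _ -> `|X| < _](_ : _ = (x - (u t0, v t0)) - (x - y)); last first.
      by rewrite opprB [RHS]addrC [RHS]addrA subrK.
    by move=> h; apply: (le_lt_trans (ler_normB _ _)); lra.
  exists t => //; have [_ _ _ [ut vt] [_ _ uvt0 nt _]] := Hd t td.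
  split => //.
  - case: x x1 x2 xy => x1 x2 /= _ _ xy; rewrite Ey in xy.
    apply: (nearest_parallel p B u v n1 n2 t0 d t x1 x2 p2 _ td xy uvt0 nt).
    by move=> s /Hd[_ _ _ _ [? [? ?] _ _ _]].
  - have := normr_fst (x - (u t0, v t0)); rewrite /= => h.
    rewrite (_ : _ - u t = (x.1 - u t0) - (u t - u t0)); last by ring.
    by apply: (le_lt_trans (ler_normB _ _)); lra.
  - have := normr_snd (x - (u t0, v t0)); rewrite /= => h.
    rewrite (_ : _ - v t = (x.2 - v t0) - (v t - v t0)); last by ring.
    by apply: (le_lt_trans (ler_normB _ _)); lra.
move=> x x' y y' xe xe' xy xy'.
have [s sd [-> Gs s1 s2]] := locx x y xe xy.
have [t td [-> Gt t1 t2]] := locx x' y' xe' xy'.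
have [sr sru srv _ [_ _ _ _ Ns]] := Hd s sd.
have [tr tru trv _ [_ _ _ _ Nt]] := Hd t td.
have st : `|s - t| <= N / q * `|x - x'|.
  rewrite mulrAC ler_pdivlMr// mulrC.
  rewrite -(distrC t s).
  have := mono t s x.1 x.2 tr sr s1 s2; rewrite Gs subrr subr0 => /le_trans; apply.
  (* The cross product of [x'] vanishes at [t], so that of [x] at [t] is linear in [x - x']. *)
  have -> : (x.1 - u t) * n2 t - (x.2 - v t) * n1 t =
    (x - x').1 * n2 t - (x - x').2 * n1 t.
    transitivity ((x - x').1 * n2 t - (x - x').2 * n1 t +
      ((x'.1 - u t) * n2 t - (x'.2 - v t) * n1 t)); first by rewrite /=; ring.
    by rewrite Gt subrr addr0.
  apply: (le_trans (ler_normB _ _)); rewrite !normrM.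
  apply: (@le_trans _ _ ((`|n1 t| + `|n2 t|) * `|x - x'|)); last by rewrite ler_wpM2r.
  have h1 : `|(x - x').1| * `|n2 t| <= `|x - x'| * `|n2 t|.
    by rewrite ler_wpM2r// normr_fst.
  have h2 : `|(x - x').2| * `|n1 t| <= `|x - x'| * `|n1 t|.
    by rewrite ler_wpM2r// normr_snd.
  by move: h1 h2; clear; lra.
apply: (@le_trans _ _ ((`|Lu| + `|Lv|) * `|s - t|)); last first.
  by rewrite -mulrA ler_wpM2l// addr_ge0.
have hu : `|u s - u t| <= `|Lu| * `|s - t|.
  by apply: (le_trans (lu _ _ sru tru)); rewrite ler_wpM2r// ler_norm.
have hv : `|v s - v t| <= `|Lv| * `|s - t|.
  by apply: (le_trans (lv _ _ srv trv)); rewrite ler_wpM2r// ler_norm.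
rewrite normr_prod_le /= mulrDl.
have := mulr_ge0 (normr_ge0 Lu) (normr_ge0 (s - t)).
have := mulr_ge0 (normr_ge0 Lv) (normr_ge0 (s - t)).
by move=> h1 h2; apply/andP; split; move: hu hv h1 h2; clear; lra.
Unshelve. all: by end_near. Qed.

(** The infimum is attained at a nearest point, the p-th root being monotone. *)
Lemma dp_nearest p U x y : 0 < p -> nearest p (boundary U) x y ->
  dp p U x = powsum p (x - y) `^ p^-1.
Proof.
move=> p0 [By ymin]; rewrite /dp.
have E z : gammap p (x - z) = powsum p (x - z) `^ p^-1 by [].
apply/eqP; rewrite eq_le; apply/andP; split.
  apply: ge_inf; last by exists y.
  by exists 0 => _ [z _ <-]; exact: powR_ge0.
apply: lb_le_inf; first by exists (gammap p (x - y)), y.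
move=> _ [z Bz <-]; rewrite E; apply: ge0_ler_powR; rewrite ?nnegrE ?invr_ge0 ?(ltW p0)//.
- by rewrite addr_ge0// powR_ge0.
- by rewrite addr_ge0// powR_ge0.
- exact: ymin.
Qed.

Lemma powsum_taylor p M (w w' : R * R) : 2 <= p -> `|w| <= M -> `|w'| <= M ->
  `|powsum p w' - powsum p w - dot2 (p * spow p w.1, p * spow p w.2) (w' - w)| <=
  2 * (p * (p - 1) * M `^ (p - 2)) * `|w' - w| ^+ 2.
Proof.
move=> p2; rewrite !normr_prod_le => /andP[w1 w2] /andP[w1' w2'].
have M0 : 0 <= M by apply: le_trans w1.
have h1 := powR_norm_taylor p M _ _ p2 w1 w1'.
have h2 := powR_norm_taylor p M _ _ p2 w2 w2'.
have c0 : 0 <= p * (p - 1) * M `^ (p - 2).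
  by rewrite mulr_ge0 ?powR_ge0// mulr_ge0//; lra.
have sq (a b : R) : 0 <= a -> a <= b -> a ^+ 2 <= b ^+ 2.
  by move=> a0 ab; rewrite lerXn2r// ?nnegrE//; lra.
have k1 := ler_wpM2l c0 (sq _ _ (normr_ge0 _) (normr_fst (w' - w))).
have k2 := ler_wpM2l c0 (sq _ _ (normr_ge0 _) (normr_snd (w' - w))).
rewrite (_ : _ - dot2 _ _ =
  (`|w'.1| `^ p - `|w.1| `^ p - p * spow p w.1 * (w'.1 - w.1)) +
  (`|w'.2| `^ p - `|w.2| `^ p - p * spow p w.2 * (w'.2 - w.2))); last first.
  by rewrite /powsum /dot2 /=; ring.
apply: (le_trans (ler_normD _ _)); move: k1 k2; rewrite /=; lra.
Qed.

(* Semiconcavity of the power of the distance is automatic, as an infimum of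
   smooth functions; comparing the expansions at two points shows that it is
   [C^{1,1}] as soon as the nearest point depends in a Lipschitz way on [x]. *)
Lemma dp_C11 p U y0 K e : 2 <= p -> open U -> boundary U y0 ->
  (forall x, exists y, nearest p (boundary U) x y) ->
  (forall x x' y y', `|x - y0| < e -> `|x' - y0| < e ->
    nearest p (boundary U) x y -> nearest p (boundary U) x' y' ->
    `|y - y'| <= K * `|x - x'|) ->
  forall x0, U x0 -> `|x0 - y0| < e ->
    exists A, [/\ open A, A x0, A `<=` U & C11 A (dp p U)].
Proof.
move=> p2 oU By0 exn nL x0 Ux0 x0e.
have p0 : 0 < p by lra.
have p1 : 1 <= p by lra.
have [near_pt nP] := choice exn.
pose D x := powsum p (x - near_pt x).
have -> : dp p U = (fun x => D x `^ p^-1).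
  by apply/funext => x; exact: dp_nearest.
have e0 : 0 < e by apply: le_lt_trans x0e.
have [r r0 rU] : exists2 r, 0 < r & forall x, `|x - x0| < r -> U x.
  have /nbhs_ballP[r /= r0 H] := open_nbhs_nbhs (conj oU Ux0).
  by exists r => // x xx0; apply: H; rewrite -ball_normE/= distrC.
(* Half of [r] keeps a distance r/2 to the boundary; the other bound stays in the ball where the
   nearest point is Lipschitz. *)
pose rr := Num.min (r / 2) (e - `|x0 - y0|).
have rr0 : 0 < rr by rewrite lt_min subr_gt0 x0e divr_gt0.
have AP x : ball x0 rr x -> `|x - x0| < r / 2 /\ `|x - y0| < e.
  rewrite -ball_normE/= distrC lt_min => /andP[? h]; split => //.
  by rewrite -(subrK x0 x) -addrA; apply: (le_lt_trans (ler_normD _ _)); lra.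
exists (ball x0 rr); split.
- exact: ball_open.
- exact: ballxx.
- by move=> x /AP[xr _]; apply: rU; lra.
(* A point is within 2 e of its nearest point, and two points of the ball are within 2 e of each
   other. *)
pose M := 4 * e.
have M0 : 0 <= M by rewrite mulr_ge0// ltW.
pose v x : R * R := (p * spow p (x - near_pt x).1, p * spow p (x - near_pt x).2).
pose C1 := (p - 1) * M `^ (p - 2).
have C1E : p * (p - 1) * M `^ (p - 2) = p * C1 by rewrite -mulrA.
have C10 : 0 <= C1 by rewrite mulr_ge0 ?powR_ge0//; lra.
have pC : 0 <= p * C1 by rewrite mulr_ge0// ltW.
have pCK : 0 <= p * C1 * (1 + `|K|) by rewrite mulr_ge0// addr_ge0.
pose C := 2 * (p * C1) + 2 * (p * C1 * (1 + `|K|)).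
have nearM x : `|x - y0| < e -> `|x - near_pt x| <= 2 * e.
  move=> xe; have := nearest_norm_le _ _ _ _ _ p1 By0 (nP x); lra.
have wM x x' : `|x - y0| < e -> `|x' - y0| < e -> `|x' - near_pt x| <= M.
  move=> xe xe'; have h := nearM x xe.
  rewrite (_ : x' - near_pt x = ((x' - y0) - (x - y0)) + (x - near_pt x)); last first.
    by rewrite opprB !addrA !subrK.
  apply: (le_trans (ler_normD _ _)).
  by have := ler_normB (x' - y0) (x - y0); rewrite /M; lra.
have vL x x' : `|x - y0| < e -> `|x' - y0| < e ->
    `|v x - v x'| <= p * C1 * (1 + `|K|) * `|x - x'|.
  move=> xe xe'; have := wM x x xe xe; have := wM x' x' xe' xe'.
  have : `|(x - near_pt x) - (x' - near_pt x')| <= (1 + `|K|) * `|x - x'|.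
    rewrite (_ : _ - _ - _ = (x - x') - (near_pt x - near_pt x')); last first.
      by rewrite !opprB addrACA [RHS]addrACA (addrC (- x')).
    apply: (le_trans (ler_normB _ _)); rewrite mulrDl mul1r lerD2l.
    apply: (le_trans (nL _ _ _ _ xe xe' (nP x) (nP x'))).
    by rewrite ler_wpM2r// ler_norm.
  rewrite /v; move: (x - near_pt x) (x' - near_pt x') => w w'.
  rewrite !normr_prod_le => /andP[d1 d2] /andP[a1 a2] /andP[b1 b2].
  rewrite -[leRHS]mulrA /= -!mulrBr !normrM (ger0_norm (ltW p0)) -!mulrA !ler_pM2l//.
  apply/andP; split.
  + by apply: (le_trans (spow_lipschitz p M _ _ p2 b1 a1)); rewrite /C1 -!mulrA;
      do 2!(rewrite ler_wpM2l ?powR_ge0//; try lra).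
  + by apply: (le_trans (spow_lipschitz p M _ _ p2 b2 a2)); rewrite /C1 -!mulrA;
      do 2!(rewrite ler_wpM2l ?powR_ge0//; try lra).
have expand x x' : `|x - y0| < e -> `|x' - y0| < e ->
    `|D x' - D x - dot2 (v x) (x' - x)| <= C * `|x' - x| ^+ 2.
  move=> xe xe'.
  have eqw (z a b : R * R) : (a - z) - (b - z) = a - b by rewrite opprB addrA subrK.
  (* Freezing the nearest point of [x] bounds D x' from above; freezing that of [x'] bounds it from
     below, with the gradient at [x'] in place of that at [x]. *)
  have T1 := powsum_taylor p M (x - near_pt x) (x' - near_pt x) p2
    (wM _ _ xe xe) (wM _ _ xe xe').
  have T2 := powsum_taylor p M (x' - near_pt x') (x - near_pt x') p2
    (wM _ _ xe' xe') (wM _ _ xe' xe).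
  rewrite eqw -/(v _) -/(D _) in T1; rewrite eqw -/(v _) -/(D _) in T2.
  have m1 : D x' <= powsum p (x' - near_pt x) := proj2 (nP x') _ (proj1 (nP x)).
  have m2 : D x <= powsum p (x - near_pt x') := proj2 (nP x) _ (proj1 (nP x')).
  rewrite (distrC x x') in T2.
  have T3 : `|dot2 (v x) (x' - x) - dot2 (v x') (x' - x)| <=
      2 * (p * C1 * (1 + `|K|)) * `|x' - x| ^+ 2.
    rewrite dot2B; apply: (le_trans (normr_dot2 _ _)); rewrite expr2 [leRHS]mulrA ler_wpM2r//.
    by rewrite -[leRHS]mulrA ler_pM2l// (distrC x' x); exact: vL.
  have T4 : dot2 (v x') (x - x') = - dot2 (v x') (x' - x).
    by rewrite /dot2 /=; ring.
  have T5 : 0 <= p * C1 * (1 + `|K|) * `|x' - x| ^+ 2.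
    by rewrite mulr_ge0.
  rewrite T4 in T2; rewrite C1E in T1 T2.
  move: T1 T2 T3; rewrite !ler_norml /C => /andP[_ a1] /andP[_ a2] /andP[a3 a4].
  by apply/andP; split; move: m1 m2 a1 a2 a3 a4 T5; clear; lra.
have vM x : `|x - y0| < e -> `|v x| <= p * M `^ (p - 1).
  move=> xe; have := wM x x xe xe; rewrite !normr_prod_le => /andP[w1 w2].
  rewrite /v/= !(normrM p) (ger0_norm (ltW p0)) !ler_pM2l// !normr_spow//.
  by apply/andP; split; apply: ge0_ler_powR; rewrite ?nnegrE//; lra.
have C0 : 0 <= C.
  by rewrite /C; lra.
(* The lower bound (r/2)^p holds because the ball of radius [r] around [x0] lies in the open set [U]
   and so contains no boundary point. *)
apply: (C11_expansion_powR _ _ v C p^-1 ((r / 2) `^ p)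
  (2 * (p * M `^ (p - 1)) + C * (2 * e))).
- exact: ball_open.
- move=> x x' /AP[_ xe] /AP[_ xe']; split; first exact: expand.
  apply: (le_trans (vL _ _ xe xe')); rewrite ler_wpM2r// /C; lra.
- by rewrite powR_gt0// divr_gt0.
- by rewrite invf_le1.
- move=> x /AP[xr xe]; split.
    apply: le_trans (powsum_ge _ _ (ltW p0)).
    apply: ge0_ler_powR; rewrite ?nnegrE ?(ltW p0)//; first by rewrite divr_ge0// ltW.
    rewrite leNgt; apply/negP => h.
    have [[_ nint] _] := nP x; apply: nint; rewrite (interior_id _).1//.
    apply: rU; rewrite -(subrK x (near_pt x)) -addrA.
    by apply: (le_lt_trans (ler_normD _ _)); rewrite (distrC (near_pt x)); lra.
  apply: (le_trans (vM x xe)).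
  have : 0 <= p * M `^ (p - 1) by rewrite mulr_ge0 ?powR_ge0// ltW.
  have : 0 <= C * (2 * e) by rewrite !mulr_ge0// ltW.
  lra.
- move=> x x' /AP[_ xe] /AP[_ xe']; rewrite (distrC (D x)) (distrC x).
  have h1 := expand x x' xe xe'.
  have h2 := normr_dot2 (v x) (x' - x).
  have h3 : 2 * `|v x| * `|x' - x| <= 2 * (p * M `^ (p - 1)) * `|x' - x|.
    by rewrite ler_wpM2r// ler_pM2l// vM.
  (* Two points of the ball are within 2 e, which makes the quadratic error linear. *)
  have h4 : C * `|x' - x| ^+ 2 <= C * (2 * e) * `|x' - x|.
    rewrite expr2 mulrA ler_wpM2r// ler_wpM2l//.
    rewrite (_ : x' - x = (x' - y0) - (x - y0)); last by rewrite opprB addrA subrK.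
    by apply: (le_trans (ler_normB _ _)); lra.
  rewrite -(subrK (dot2 (v x) (x' - x)) (D x' - D x)).
  by apply: (le_trans (ler_normD _ _)); lra.
Qed.

End DistanceRegularity.

(** * Existence of the normal field *)

Section NormalFieldExistence.
Context {R : realType}.
Implicit Types (p : R).

(** The exponents p - 1 and p/(p-1) - 1 are inverse to each other, so [spow] of the conjugate
    exponent inverts [spow p]. *)
Lemma spow_conj p (y : R) : 2 <= p -> spow p (spow (p / (p - 1)) y) = y.
Proof.
move=> p2; have [->|y0] := eqVneq y 0; first by rewrite !spow0.
have ny : `|y| != 0 by rewrite normr_eq0.
rewrite /spow normrM (ger0_norm (powR_ge0 _ _)).
rewrite -[X in (X * _ `^ (p / _ - _)) `^ _]powRr1// -powRD; last by rewrite ny implybT.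
rewrite -powRrM -mulrA -powRD; last by rewrite ny implybT.
rewrite (_ : _ + _ = 0); last by field; rewrite gt_eqF//; lra.
by rewrite powRr0 mulr1.
Qed.

(** For q <= 2 the factor |x|^(q-2) is singular at most at 0; on |x| >= |a|/2 it is bounded and
    Lipschitz. The case needed is q = p/(p-1). *)
Lemma locally_lipschitz_spow (q a : R) : q <= 2 -> a != 0 ->
  locally_lipschitz (spow q) a.
Proof.
move=> q2 a0; have na : 0 < `|a| by rewrite normr_gt0.
have lo0 : 0 < `|a| / 2 by rewrite divr_gt0.
pose K := (`|a| / 2) `^ (q - 2).
exists (K + 2 * `|a| * (`|q - 2| * (`|a| / 2) `^ (q - 2 - 1))), (`|a| / 2) => //.
move=> x y xa ya.
have lox : `|a| / 2 <= `|x|.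
  by have := lerB_dist a x; rewrite (distrC a); lra.
have loy : `|a| / 2 <= `|y|.
  by have := lerB_dist a y; rewrite (distrC a); lra.
have hiy : `|y| <= 2 * `|a|.
  by have := lerB_dist y a; lra.
have xK : `| `|x| `^ (q - 2)| <= K.
  rewrite ger0_norm ?powR_ge0// /K -(opprB 2 q) !powRN.
  have x0 : 0 < `|x| by apply: lt_le_trans lox.
  rewrite lef_pV2 ?posrE ?powR_gt0//.
  by apply: ge0_ler_powR; rewrite ?nnegrE; lra.
have h := powR_ge_lipschitz (q - 2) _ _ _ lo0 lox loy ltac:(lra).
have -> : spow q x - spow q y =
  `|x| `^ (q - 2) * (x - y) + y * (`|x| `^ (q - 2) - `|y| `^ (q - 2)).
  by rewrite /spow; ring.
apply: (le_trans (ler_normD _ _)); rewrite !normrM mulrDl; apply: lerD.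
  by rewrite ler_wpM2r.
rewrite -[leRHS]mulrA; apply: ler_pM => //; apply: (le_trans h).
by rewrite ler_wpM2l ?mulr_ge0 ?powR_ge0// ler_dist_dist.
Qed.

Lemma p_normal_fieldC p (u v n1 n2 : R -> R) (t0 : R) :
  p_normal_field p u v n1 n2 t0 -> p_normal_field p v u n2 n1 t0.
Proof.
move=> [l1 l2 n0 E]; split=> //; first by case: n0; [right|left].
by apply: filterS E => t; rewrite addrC.
Qed.

(** The field is the inverse of [spow p] applied to the Euclidean normal (-v', u'); it is Lipschitz
    because neither coordinate vanishes at [t0]. *)
Lemma generic_normal_field p (u v : R -> R) (t0 : R) : 2 <= p ->
  C11_at u t0 -> C11_at v t0 ->
  u^`()%classic t0 != 0 -> v^`()%classic t0 != 0 ->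
  p_normal_field p u v (spow (p / (p - 1)) \o (fun t => - v^`()%classic t))
    (spow (p / (p - 1)) \o u^`()%classic) t0.
Proof.
move=> p2 [_ lu] [_ lv] u0 v0.
have q2 : p / (p - 1) <= 2 by rewrite ler_pdivrMr; lra.
split.
- apply: locally_lipschitz_comp.
    have [L [r r0 H]] := lv; exists L, r => // x y xr yr.
    by rewrite -opprD normrN; exact: H.
  by apply: locally_lipschitz_spow; rewrite ?oppr_eq0.
- by apply: locally_lipschitz_comp => //; exact: locally_lipschitz_spow.
- right; apply: contraNneq u0 => /= E.
  by rewrite -(spow_conj p (u^`()%classic t0) p2) E spow0.
- by near=> t; rewrite /= !spow_conj//; ring.
Unshelve. all: by end_near. Qed.

Lemma spow_sign p (e : bool) (a : R) :
  spow p ((-1) ^+ e * a) = (-1) ^+ e * spow p a.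
Proof. by case: e; rewrite ?expr1 ?expr0 ?mulN1r ?mul1r ?spowN. Qed.

(* [e1] and [e2] are the reflections of the axes in [signed_swap]. *)
Lemma graph_normal_field p (u v b c : R -> R) (t0 e : R) (e1 e2 : bool) :
  0 < e -> C11_at u t0 -> C11_at v t0 -> locally_lipschitz c 0 ->
  (forall s : R, `|s| < e -> is_derive s 1 b (spow p (c s))) ->
  (\forall t \near t0, exists2 s, `|s| < e &
     ((-1) ^+ e1 * u t, (-1) ^+ e2 * v t) = (s + (-1) ^+ e1 * u t0, b s)) ->
  p_normal_field p u v (fun t => - ((-1) ^+ e1 * c ((-1) ^+ e1 * (u t - u t0))))
    (fun=> (-1) ^+ e2) t0.
Proof.
move=> e0 Cu Cv lc db gr; have duv := filterI (proj1 Cu) (proj1 Cv).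
(* The graph parameter [s] of the curve point at [t]. *)
pose sg t := (-1) ^+ e1 * (u t - u t0).
have s1 (k : bool) : `|(-1) ^+ k : R| = 1 by rewrite normrX normrN1 expr1n.
split.
- have lsg : locally_lipschitz sg t0.
    have [L [r r0 H]] := C11_at_lipschitz _ _ Cu; exists L, r => // x y xr yr.
    by rewrite /sg -mulrBr opprB addrA subrK normrM s1 mul1r; exact: H.
  have sg0 : sg t0 = 0 by rewrite /sg subrr mulr0.
  rewrite -sg0 in lc.
  have [L [r r0 H]] := locally_lipschitz_comp _ _ _ lsg lc; exists L, r => // x y xr yr.
  by rewrite -opprD normrN -mulrBr normrM s1 mul1r; exact: H.
- exists 0, 1 => // x y _ _; by rewrite subrr normr0 mul0r.
- by right; rewrite -normr_eq0 s1 oner_neq0.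
- have gr' : \forall t \near t0, `|sg t| < e /\ (-1) ^+ e2 * v t = b (sg t).
    apply: filterS gr => t [s se [E1 E2]].
    have -> : sg t = s by rewrite /sg mulrBr E1 addrK.
    by rewrite E2.
  have {}gr' := filterI gr' (near_join gr').
  near=> t.
  have [[te _] Et] : (`|sg t| < e /\ (-1) ^+ e2 * v t = b (sg t)) /\
    \forall t \near t, `|sg t| < e /\ (-1) ^+ e2 * v t = b (sg t).
    by near: t; exact: gr'.
  have [dut dvt] : derivable u t 1 /\ derivable v t 1 by near: t; exact: duv.
  have Dsg : is_derive t 1 sg ((-1) ^+ e1 * u^`()%classic t).
    have D1 : is_derive t 1 (fun t => u t - u t0) (u^`()%classic t).
      rewrite derive1E -[X in is_derive _ _ _ X]subr0.
      have D0 := derivableP dut; have Dc := is_derive_cst (u t0) t (1 : R).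
      exact: is_deriveB D0 Dc.
    exact: is_deriveZ.
  have Dbs := @is_derive1_comp R b sg t _ _ (db _ te) Dsg.
  have Dv : is_derive t 1 (fun t => (-1) ^+ e2 * v t) ((-1) ^+ e2 * v^`()%classic t).
    have D1 : is_derive t 1 v (v^`()%classic t) by rewrite derive1E; exact: derivableP.
    exact: is_deriveZ.
  have Dv' : is_derive t 1 (fun t => (-1) ^+ e2 * v t)
      (spow p (c (sg t)) * ((-1) ^+ e1 * u^`()%classic t)).
    apply: near_eq_is_derive Dbs; apply: filterS Et => s [_ ->] //.
  have : (-1) ^+ e2 * v^`()%classic t =
      spow p (c (sg t)) * ((-1) ^+ e1 * u^`()%classic t).
    have [_ <-] := Dv; have [_ <-] := Dv'; by [].
  have -> : spow p ((-1) ^+ e2) = (-1) ^+ e2.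
    by rewrite -[X in spow p X]mulr1 spow_sign spow1 mulr1.
  rewrite spowN spow_sign.
  by move=> ->; rewrite /sg; ring.
Unshelve. all: by end_near. Qed.

End NormalFieldExistence.

(** * Regularity of the boundary arcs and the field at axis-parallel normals *)

Section Arcs.
Context {R : realType}.

Lemma arc_C11_at (k0 : nat) (al0 : R) (g : R -> R * R) (t : R) : (3 <= k0)%N ->
  CkHolder_arc k0 al0 g \/ analytic_arc g -> t \in `[0, 1] ->
  C11_at (fst \o g) t /\ C11_at (snd \o g) t.
Proof.
move=> k3 [[e e0 [g1 g2]] t01|ga /ga[g1 g2]]; last first.
  by split; exact: analytic_C11_at.
have te : `]- e, 1 + e[%classic t.
  by move: t01; rewrite /= !in_itv/= => /andP[? ?]; apply/andP; split; lra.
have oe : open (`]- e, 1 + e[%classic : set R) by exact: interval_open.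
by split; [exact: CkHolder_C11_at g1 | exact: CkHolder_C11_at g2].
Qed.

Lemma arc_continuous (k0 : nat) (al0 : R) (g : R -> R * R) : (3 <= k0)%N ->
  CkHolder_arc k0 al0 g \/ analytic_arc g -> {within `[0, 1], continuous g}.
Proof.
move=> k3 ga; apply: continuous_in_subspaceT => t /set_mem t01.
have [g1 g2] := arc_C11_at _ _ _ _ k3 ga t01.
have c1 := locally_lipschitz_continuous _ _ (C11_at_lipschitz _ _ g1).
have c2 := locally_lipschitz_continuous _ _ (C11_at_lipschitz _ _ g2).
have -> : g = (fun t => ((fst \o g) t, (snd \o g) t)).
  by apply/funext => s /=; case: (g s).
exact: cvg_pair c1 c2.
Qed.

Lemma axis_parallel_normal_field (p : R) (k0 : nat) (al0 : R) (U : set (R * R))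
    (g : R -> R * R) (t0 : R) (sw e1 e2 : bool) (e : R) (b c : R -> R) :
  (3 <= k0)%N -> 0 < t0 < 1 ->
  C11_at (fst \o g) t0 -> C11_at (snd \o g) t0 ->
  graph_below U g t0 (signed_swap sw e1 e2) e b ->
  (forall s : R, `|s| < e -> is_derive s 1 b (c s * `|c s| `^ (p - 2))) ->
  CkHolder k0.-1 al0 `]- e, e[%classic c ->
  exists n1 n2, p_normal_field p (fst \o g) (snd \o g) n1 n2 t0.
Proof.
move=> k3 /andP[t00 t01] C1 C2 [e0 _ [d d0 gr]] db [dc _].
have e0I : `]- e, e[%classic (0 : R) by rewrite /= in_itv/= oppr_lt0 e0.
have lc : locally_lipschitz c 0.
  apply: (locally_lipschitz_of_derive _ c^`()%classic).
    have oe : open (`]- e, e[%classic : set R) by exact: interval_open.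
    have := open_nbhs_nbhs (conj oe e0I); apply: filterS => s se; rewrite derive1E.
    by apply: derivableP; apply: (dc 0%N) => //; lia.
  apply/differentiable_continuous/derivable1_diffP; rewrite -derive1n1.
  by apply: dc => //; lia.
have near_gr : \forall t \near t0, exists2 s, `|s| < e &
    signed_swap sw e1 e2 (g t) = (s + (signed_swap sw e1 e2 (g t0)).1, b s).
  (* The bounds [t0] and 1 - t0 keep [t] in the parameter interval. *)
  apply/near_ball_ex; exists (Num.min d (Num.min t0 (1 - t0))).
    by rewrite !lt_min d0 t00 subr_gt0.
  move=> t; rewrite !lt_min => /andP[td /andP[t1 t2]].
  have t01' : t \in `[0, 1].
    by move: t1 t2; rewrite !ltr_norml in_itv/= => /andP[? ?] /andP[? ?];
      apply/andP; split; lra.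
  by have [] := gr t t01' td.
(* Interchanging the axes exchanges [u] with [v] and [n1] with [n2]. *)
case: sw gr near_gr => _ near_gr.
- have := graph_normal_field p (snd \o g) (fst \o g) b c t0 e e1 e2 e0 C2 C1 lc db near_gr.
  by move=> /p_normal_fieldC H; eexists; eexists; exact: H.
- have H := graph_normal_field p (fst \o g) (snd \o g) b c t0 e e1 e2 e0 C1 C2 lc db near_gr.
  by eexists; eexists; exact: H.
Qed.

End Arcs.

(** * Boundary of a Jordan domain *)

Section JordanBoundary.
Context {R : realType}.

(** A finite union of continuous images of a segment. *)
Lemma jordan_boundary_compact (k0 : nat) (al0 : R) (U : set (R * R)) (m : nat)
    (S : 'I_m -> R -> R * R) : (3 <= k0)%N ->
  jordan_boundary k0 al0 U S -> compact (boundary U).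
Proof.
move=> k3 [-> _ _ Sreg _].
have -> : [set: 'I_m] = [set` index_enum 'I_m].
  by apply/seteqP; split => // i _ /=; exact: mem_index_enum.
rewrite bigcup_seq; apply: bigsetU_compact => i _.
apply: continuous_compact; last exact: segment_compact.
exact: arc_continuous _ _ _ k3 (Sreg i).
Qed.

Lemma ex_nearest (p : R) (B : set (R * R)) (x : R * R) : 2 <= p ->
  compact B -> B !=set0 -> exists y, nearest p B x y.
Proof.
move=> p2 cB B0.
have cpow (t : R) : {for t, continuous (fun t : R => `|t| `^ p)}.
  have [D _] := is_derive_powR_norm p t p2.
  exact/differentiable_continuous/derivable1_diffP.
have c1 (y : R * R) : {for y, continuous (fun y : R * R => x.1 - y.1)}.
  by apply: cvgB; [exact: cvg_cst | exact: cvg_fst].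
have c2 (y : R * R) : {for y, continuous (fun y : R * R => x.2 - y.2)}.
  by apply: cvgB; [exact: cvg_cst | exact: cvg_snd].
have [|y /set_mem By ymin] := @compact_EVT_min _ R (fun y : R * R => powsum p (x - y)) B B0 cB.
  apply: continuous_subspaceT => y.
  apply: (@cvgD _ _ _ _ _ (fun y : R * R => `|x.1 - y.1| `^ p)
    (fun y : R * R => `|x.2 - y.2| `^ p)).
  - exact: (continuous_comp (c1 y) (cpow _)).
  - exact: (continuous_comp (c2 y) (cpow _)).
by exists y; split => // z Bz; apply: ymin; exact: mem_set.
Qed.

Lemma ord_pred_vertex (k0 : nat) (al0 : R) (U : set (R * R)) (m : nat)
    (S : 'I_m -> R -> R * R) (i : 'I_m) :
  jordan_boundary k0 al0 U S -> S i 0 = vertex S (ord_pred i).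
Proof. by move=> [_ S1 _ _ _]; rewrite /vertex S1 ord_predK. Qed.

Lemma smooth_point_param (k0 : nat) (al0 : R) (U : set (R * R)) (m : nat)
    (S : 'I_m -> R -> R * R) (y0 : R * R) :
  jordan_boundary k0 al0 U S -> boundary U y0 ->
  (forall i, y0 <> vertex S i) -> exists i, exists2 t, 0 < t < 1 & y0 = S i t.
Proof.
move=> HS; have [BU _ _ _ _] := HS.
rewrite BU => -[i _ [t]]; rewrite /= in_itv/= !le_eqVlt => + <- nV.
move=> /andP[/predU1P[t0|t0] /predU1P[t1|t1]].
- by move: t1; rewrite -t0 => /esym/eqP; rewrite oner_eq0.
(* The start of an arc is the vertex at the end of the preceding arc. *)
- by case: (nV (ord_pred i)); rewrite -t0 (ord_pred_vertex _ _ _ _ _ _ HS).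
- by case: (nV i); rewrite t1.
- by exists i, t => //; rewrite t0.
Qed.

(** The rest of the boundary, namely the other arcs and the part of arc [i] with parameters at
    distance at least [d] from [t0], is a finite union of compact sets missing [S i t0]; hence some
    ball avoids it. *)
Lemma boundary_near_smooth_point (k0 : nat) (al0 : R) (U : set (R * R)) (m : nat)
    (S : 'I_m -> R -> R * R) (i : 'I_m) (t0 d : R) : (3 <= k0)%N ->
  jordan_boundary k0 al0 U S -> 0 < t0 < 1 -> (forall j, S i t0 <> vertex S j) ->
  0 < d -> exists2 rho, 0 < rho & forall y, boundary U y ->
    `|y - S i t0| < rho -> exists2 t, `|t - t0| < d & y = S i t.
Proof.
move=> k3 [BU _ Sinj Sreg _] /andP[t00 t01] nV d0.
(* For j other than i the condition is vacuous, so the whole arc is removed. *)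
pose far (j : 'I_m) : set R := [set t : R | j = i -> d <= `|t - t0|].
have cfar j : closed (far j).
  have [ji|/eqP ji] := eqVneq j i; last first.
    by rewrite (_ : far j = setT) //; apply/seteqP; split => // t _ /ji.
  rewrite (_ : far j = (fun t : R => `|t - t0|) @^-1` [set x | d <= x]).
    apply: (@closed_comp _ _ (fun t : R => `|t - t0|)); last exact: closed_ge.
    move=> t _; apply: (@continuous_comp _ _ _ (fun t : R => t - t0)).
      by apply: cvgB; [exact: cvg_id|exact: cvg_cst].
    exact: norm_continuous.
  by apply/seteqP; split => t /=; [exact|move=> ? _].
have cK j : closed (S j @` (`[0, 1] `&` far j)).
  apply: compact_closed; first exact: norm_hausdorff.
  apply: continuous_compact.
    apply: continuous_subspaceW (arc_continuous _ _ _ k3 (Sreg j)).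
    exact: subIsetl.
  by apply: compact_closedI; first exact: segment_compact.
have nK j : ~ (S j @` (`[0, 1] `&` far j)) (S i t0).
  move=> [t [/= + tfar] E]; rewrite in_itv/= [t <= 1]le_eqVlt.
  move=> /andP[t0' /predU1P[t1|t1]].
    (* Injectivity is stated on half-open intervals; the excluded end t = 1 is a vertex. *)
    by case: (nV j); rewrite -E t1.
  have [||ji tt] := Sinj j i t t0 _ _ E.
  - by rewrite in_itv/= t0'.
  - by rewrite in_itv/= ltW.
  by have := tfar ji; rewrite tt subrr normr0 leNgt d0.
have : \forall y \near S i t0, forall j, ~ (S j @` (`[0, 1] `&` far j)) y.
  apply: (@filter_forall _ _ (fun j => ~` (S j @` (`[0, 1] `&` far j)))
    (nbhs (S i t0))) => j.
  by apply: open_nbhs_nbhs; split; [exact: closed_openC (cK j)|exact: nK].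
move=> /nbhs_ballP[rho /= rho0 H]; exists rho => // y; rewrite BU => -[j _ [t t01' Sy]] yr.
have [tf|td] := pselect (far j t).
  case: (H y _ j); last by exists t.
  by rewrite -ball_normE/= distrC.
have {}td : j = i /\ `|t - t0| < d.
  have [ji td'] : j = i /\ ~ d <= `|t - t0|.
    by split; [apply: contrapT => ji; apply: td => /ji|move=> dt; apply: td].
  by split => //; rewrite ltNge; apply/negP.
by case: td => ji td; exists t => //; rewrite -Sy ji.
Qed.

End JordanBoundary.

(** * Absence of ridge points near a smooth boundary point *)

Theorem theorem2 (R : realType) (p : R) (k0 : nat) (al0 : R)
    (U : set (R * R)) (m : nat) (S : 'I_m -> R -> R * R)
    (hp : 2 <= p) (hk0 : (3 <= k0)%N) (hal0 : 0 < al0 < 1)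
    (Uopen : open U) (Ubounded : bounded_set U) (Usc : simply_connected U)
    (hm : (0 < m)%N) (hS : jordan_boundary k0 al0 U S)
    (hV : forall i : 'I_m, nonreentrant U (vertex S i))
    (hA : axis_parallel_condition p k0 al0 U S)
    (y0 : R * R) (hy0 : boundary U y0)
    (hy0V : forall i : 'I_m, y0 <> vertex S i) :
  exists W : set (R * R),
    [/\ open W, W y0 & W `&` U `&` pridge p U = set0].
Proof.
have [i [t0 t01 y0E]] := smooth_point_param _ _ _ _ _ _ hS hy0 hy0V.
have [BU _ _ Sreg Stan] := hS.
have t01' : t0 \in `[0, 1].
  by move: t01; rewrite in_itv/= => /andP[? ?]; rewrite !ltW.
have [C1 C2] := arc_C11_at _ _ _ _ hk0 (Sreg i) t01'.
have tan0 : (fst \o S i)^`()%classic t0 != 0 \/ (snd \o S i)^`()%classic t0 != 0.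
  have := Stan i t0 t01'; rewrite /tangent -pair_eqE/= negb_and.
  by case/orP; [left|right].
have [n1 [n2 nf]] : exists n1 n2, p_normal_field p (fst \o S i) (snd \o S i) n1 n2 t0.
  (* If the normal is parallel to an axis, the standing assumption provides the field; otherwise
     both tangent coordinates are nonzero and [spow p] can be inverted. *)
  have [par|npar] := pselect (axis_parallel (normal_at (S i) t0)).
    have [sw [e1 [e2 [e [b [c [gr db _ lc _]]]]]]] := hA i t0 t01' par.
    exact: axis_parallel_normal_field hk0 t01 C1 C2 gr db lc.
  do 2!eexists; apply: generic_normal_field => //.
    by apply/eqP => u0; apply: npar; right.
  by apply/eqP => v0; apply: npar; left; rewrite /= v0 oppr0.
have y0E' : y0 = ((fst \o S i) t0, (snd \o S i) t0) by rewrite y0E /=; case: (S i t0).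
have nB : \forall t \near t0, boundary U ((fst \o S i) t, (snd \o S i) t).
  have /andP[t00 t10] := t01.
  near=> t; rewrite BU; exists i => //; exists t; last by rewrite /=; case: (S i t).
  by rewrite /= in_itv/=; apply/andP; split; apply: ltW; near: t;
    [exact: lt_nbhsr|exact: lt_nbhsl].
have loc d : 0 < d -> exists2 rho, 0 < rho & forall y, boundary U y ->
    `|y - ((fst \o S i) t0, (snd \o S i) t0)| < rho ->
    exists2 t, `|t - t0| < d & y = ((fst \o S i) t, (snd \o S i) t).
  move=> d0; have nV j : S i t0 <> vertex S j by rewrite -y0E.
  have [rho rho0 H] := boundary_near_smooth_point _ _ _ _ _ i _ _ hk0 hS t01 nV d0.
  exists rho => // y By; rewrite -y0E' y0E => /(H y By)[t td ->].
  by exists t => //=; case: (S i t).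
have [K [e e0 nL]] := nearest_lipschitz p (boundary U) _ _ n1 n2 t0 hp C1 C2 tan0 nf nB loc.
rewrite -y0E' in nL.
have exn x : exists y, nearest p (boundary U) x y.
  apply: ex_nearest => //; first exact: jordan_boundary_compact hk0 hS.
  by exists y0.
(* On this ball the nearest point is Lipschitz, so each of its points in [U] has a neighborhood
   where the distance is C^{1,1}. *)
exists (ball y0 e); split; [exact: ball_open|exact: ballxx|].
rewrite -subset0 => x [[+ Ux] [_]]; rewrite -ball_normE/= distrC => xe; apply.
exact: dp_C11 hp Uopen hy0 exn nL x Ux xe.
Unshelve. all: by end_near. Qed.
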